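(* Let $E\subset\mathbb{R}^3$ be a compact set, let $q$ be a real number, and let $0<k\le k(E)$. Then there is a unique $k$-equilibrium distribution in $Ch(E,q)$, that is, there exists exactly one $l_k\in Ch(E,q)$ such that $$W_k(l_k)=\inf\{W_k(l):\ l\in Ch(E,q)\}.$$
   Context: $\Im$ denotes the space of infinitely differentiable compactly supported real functions on $\mathbb{R}^3$, and $\Im^*$ the space of generalized functions (distributions), i.e. continuous linear functionals on $\Im$. For $l\in\Im^*$, $\mathrm{supp}(l)$ is the smallest closed set such that $l(\varphi)=0$ for every $\varphi\in\Im$ with $\mathrm{supp}(\varphi)\cap\mathrm{supp}(l)=\emptyset$. If $\mathrm{supp}(l)$ is compact, $l(\varphi)$ is defined in the natural way for every infinitely differentiable $\varphi$, not necessarily compactly supported; in particular $l(1)$ is defined. The Dirichlet class $\mathbf{D}$ is the Hilbert space obtained by completing $\Im$ in the norm $\|f\|_{\mathbf{D}}^2=\int_{\mathbb{R}^3}\|\nabla f\|^2\,dv$; its elements are (real) functions, identified when equal almost everywhere, with generalized first-order partial derivatives in $L_2(\mathbb{R}^3)$. A generalized function $l$ belongs to $\mathbf{D}^*$ if there is $M<\infty$ with $|l(\varphi)|\le M\|\varphi\|_{\mathbf{D}}$ for all $\varphi\in\mathbf{D}$ ($l$ being extended by continuity from $\Im$ to $\mathbf{D}$). For a compact set $F\subset\mathbb{R}^3$ and real $q$, $Ch(F,q)$ is the set of all $l\in\mathbf{D}^*$ with $\mathrm{supp}(l)\subseteq F$ and $l(1)=q$. For a set $F$, $k(F)>0$ is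 the greatest number such that $k^2(F)\int_F|f|^2\,dv\le\frac{1}{4\pi}\int_{\mathbb{R}^3}\|\nabla f\|^2\,dv$ for every $f\in\mathbf{D}$ (with $k(F)=+\infty$ if the inequality holds with every number in place of $k(F)$). For $f,g\in\mathbf{D}$ put $(f,g)_k=\frac{1}{4\pi}\int_{\mathbb{R}^3}(\nabla f,\nabla g)\,dv-k^2\int_E f g\,dv$. The $k$-potential function of $l\in\mathbf{D}^*$ is the unique function $U_k^l\in\mathbf{D}$ such that $l(\varphi)=(\varphi,U_k^l)_k$ for all $\varphi\in\mathbf{D}$; it is a standing assumption that this function exists and is unique for every $l\in\mathbf{D}^*$. The $k$-potential energy of $l\in\mathbf{D}^*$ is $W_k(l)=l(U_k^l)=(U_k^l,U_k^l)_k$.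
   Formalization: The formal theorem additionally assumes that Ch(E,q) is nonempty; without this the claim fails, e.g. for E empty and q = 1, where Ch(E,q) is empty and no minimizer exists. *)

(* Defs.v *)
From HB Require Import structures.
From mathcomp Require Import all_boot all_order all_algebra.
From mathcomp Require Import all_classical all_reals all_analysis.

Set Implicit Arguments.
Unset Strict Implicit.
Unset Printing Implicit Defensive.

Import Order.TTheory GRing.Theory Num.Theory.
Import numFieldNormedType.Exports.

Local Open Scope classical_set_scope.
Local Open Scope ring_scope.

(* Euclidean 3-space, with the product topology (sup norm). *)
Notation R3 R := (R * R * R)%type.

(* The library's Lebesgue measure lives on measurableTypeR R, an alias of R
   carrying the Borel sigma-algebra; so does its threefold product, on an alias
   of R3 R carrying the product (Borel) sigma-algebra. *)
Notation mR3 R :=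
  (measurableTypeR R * measurableTypeR R * measurableTypeR R)%type.

Definition volume (R : realType) :
    {measure set (mR3 R) -> \bar R} :=
  ((@lebesgue_measure R \x @lebesgue_measure R) \x @lebesgue_measure R)%E.

Section test_functions.
Context {R : realType}.
Implicit Types (f g : R3 R -> R) (i : 'I_3) (s : seq 'I_3).

Definition unit_vec i : R3 R :=
  ((i == 0 :> nat)%N%:R, (i == 1 :> nat)%N%:R, (i == 2 :> nat)%N%:R).

Definition partial i f : R3 R -> R := fun x => 'D_(unit_vec i) f x.

Definition partials s f : R3 R -> R := foldr partial f s.

Definition smooth f := forall s, continuous (partials s f) /\
  forall i x, derivable (partials s f) x (unit_vec i).

Definition fun_supp f : set (R3 R) := closure [set x | f x != 0].

Definition is_test f := smooth f /\ compact (fun_supp f).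

Definition test_pred : {pred R3 R -> R} := fun f => `[< is_test f >].

Lemma partials_lin (a : R) f g s : smooth f -> smooth g ->
  partials s (a *: f + g) = a *: partials s f + partials s g.
Proof.
move=> sf sg; elim: s => [//|i s IHs] /=.
rewrite IHs; apply/funext => x; rewrite /partial deriveD.
- by rewrite deriveZ//; exact: (sf s).2.
- by apply: derivableZ; exact: (sf s).2.
- exact: (sg s).2.
Qed.

Lemma smooth_lin (a : R) f g : smooth f -> smooth g -> smooth (a *: f + g).
Proof.
move=> sf sg s; rewrite partials_lin//; split.
- move=> x; apply: cvgD; last exact: (sg s).1.
  by apply: cvgZr; exact: (sf s).1.
- move=> i x; apply: derivableD; last exact: (sg s).2.
  by apply: derivableZ; exact: (sf s).2.
Qed.

Lemma partials0 s : partials s (0 : R3 R -> R) = 0.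
Proof.
elim: s => [//|i s IHs] /=; rewrite IHs; apply/funext => x.
by rewrite /partial -[0]/(cst 0) derive_cst.
Qed.

Lemma test_pred_submod_closed : submod_closed test_pred.
Proof.
split=> [|a f g /asboolP[sf cf] /asboolP[sg cg]].
  apply/asboolP; split=> [s|].
    rewrite partials0; split=> [x|i x]; first exact: cst_continuous.
    exact: derivable_cst.
  rewrite /fun_supp (_ : [set _ | _] = set0); last first.
    by apply/seteqP; split=> x //=; rewrite eqxx.
  by rewrite closure0; exact: compact0.
apply/asboolP; split; first exact: smooth_lin.
apply: (subclosed_compact _ (compactU cf cg)); first exact: closed_closure.
rewrite /fun_supp -closureU; apply: closure_subset => x /=.
apply: contraNP => /not_orP[/negP + /negP +].
by rewrite !negbK => /eqP fx0 /eqP gx0; rewrite /= !fctE fx0 gx0 scaler0 addr0.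
Qed.

HB.instance Definition _ :=
  GRing.isSubmodClosed.Build R (R3 R -> R) test_pred test_pred_submod_closed.

End test_functions.
Arguments test_pred R : clear implicits.

Record test (R : realType) := Test {
  test_val :> R3 R -> R ;
  _ : test_val \in test_pred R }.

HB.instance Definition _ (R : realType) := [isSub for @test_val R].
HB.instance Definition _ (R : realType) := [Choice of test R by <:].
HB.instance Definition _ (R : realType) :=
  [SubChoice_isSubLmodule of test R by <:].

Definition test_cvg (R : realType) (phi_ : nat -> test R) (phi : test R) :=
  (exists2 K : set (R3 R), compact K & forall n, fun_supp (phi_ n) `<=` K) /\
  forall (s : seq 'I_3) (e : R), 0 < e -> \forall n \near \oo,
    forall x, `|partials s (phi_ n) x - partials s phi x| <= e.

Record gen_function (R : realType) := GenFunction {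
  gf_form :> {scalar test R} ;
  gf_continuous : forall phi_ phi, test_cvg phi_ phi ->
    gf_form (phi_ n) @[n --> \oo] --> gf_form phi }.

Lemma gen_function_ext (R : realType) (l l' : gen_function R) :
  l =1 l' -> l = l'.
Proof.
case: l l' => [f c] [f' c'] /= eff'.
suff e : f = f' by subst f'; congr GenFunction; exact: Prop_irrelevance.
case: f f' {c c'} eff' => [f cf] [f' cf'] /= eff'.
have e : f = f' by exact/funext.
subst f'; congr (GRing.Linear.Pack _).
case: cf cf' {eff'} => [[a] [b]] [[a'] [b']].
by rewrite (Prop_irrelevance a a') (Prop_irrelevance b b').
Qed.

Section gen_functions.
Context {R : realType}.
Implicit Types (l : gen_function R) (f : R3 R -> R).

Definition gf_supp l : set (R3 R) :=
  \bigcap_(S in [set S : set (R3 R) | closed S /\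
     forall phi : test R, fun_supp phi `&` S = set0 -> l phi = 0]) S.

(* For smooth f, and l of compact support, l(f) is the value of l at any test
   function equal to f near supp(l), such as chi * f for a cutoff chi. *)
Definition is_cvalue l f (y : R) := exists phi : test R,
  (exists U, [/\ open U, gf_supp l `<=` U & {in U, phi =1 f}]) /\ y = l phi.

Definition cvalue l f : R := xget 0 (is_cvalue l f).

End gen_functions.

Section dirichlet_class.
Context {R : realType}.
Let mu := @volume R.
Implicit Types (f g : R3 R -> R) (G : 'I_3 -> R3 R -> R).

Definition L2_on (A : set (R3 R)) f :=
  measurable_fun (A : set (mR3 R)) f /\ (\int[mu]_(x in A) ((f x) ^+ 2)%:E < +oo)%E.

Definition L2_cvg_on (A : set (R3 R)) (f_ : nat -> R3 R -> R) f :=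
  (\int[mu]_(x in A) ((f_ n x - f x) ^+ 2)%:E)%E @[n --> \oo] --> 0%E.

Definition generalized_partial (i : 'I_3) f g := forall phi : test R,
  \int[mu]_x (f x * partial i phi x) = - \int[mu]_x (g x * phi x).

Definition is_dgrad f G :=
  (forall i, L2_on setT (G i) /\ generalized_partial i f (G i)) /\
  exists phi_ : nat -> test R,
    (forall K, compact K -> L2_cvg_on K phi_ f) /\
    (forall i, L2_cvg_on setT (fun n => partial i (phi_ n)) (G i)).

(* A sequence of test functions that is Cauchy in the Dirichlet norm converges
   in L2 on compact sets (Hardy's inequality), so the completion is realized by
   the limits; local convergence excludes the nonzero constants. *)
Definition dirichlet f := measurable_fun [set: mR3 R] f /\ exists G, is_dgrad f G.

Definition dgrad f : 'I_3 -> R3 R -> R := xget (fun _ _ => 0) (is_dgrad f).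

Definition denergy f : \bar R :=
  (\int[mu]_x (\sum_i (dgrad f i x) ^+ 2)%:E)%E.

Definition dnorm f : R := Num.sqrt (fine (denergy f)).

(* k(F); the supremum over k >= 0 is attained when finite. *)
Definition poincare_const (F : set (R3 R)) : \bar R :=
  ereal_sup [set k%:E | k in [set k : R | 0 <= k /\
    forall f, dirichlet f ->
      ((k ^+ 2)%:E * \int[mu]_(x in F) ((f x) ^+ 2)%:E
        <= ((4 * pi)^-1)%:E * denergy f)%E]].

Definition kform (E : set (R3 R)) (k : R) f g : R :=
  (4 * pi)^-1 * (\int[mu]_x (\sum_i dgrad f i x * dgrad g i x))
  - k ^+ 2 * (\int[mu]_(x in E) (f x * g x)).

Implicit Type l : gen_function R.

(* Extension by continuity of l from test functions to the Dirichlet class. *)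
Definition is_dvalue l f (y : R) := forall phi_ : nat -> test R,
  dnorm (fun x => phi_ n x - f x) @[n --> \oo] --> 0 ->
  l (phi_ n) @[n --> \oo] --> y.

Definition dvalue l f : R := xget 0 (is_dvalue l f).

Definition dual_dirichlet l := exists M : R, forall f, dirichlet f ->
  is_dvalue l f (dvalue l f) /\ `|dvalue l f| <= M * dnorm f.

Definition Ch (F : set (R3 R)) (q : R) : set (gen_function R) :=
  [set l | [/\ dual_dirichlet l, gf_supp l `<=` F & cvalue l (cst 1) = q]].

Definition is_kpotential (E : set (R3 R)) (k : R) l (U : R3 R -> R) :=
  dirichlet U /\ forall f, dirichlet f -> dvalue l f = kform E k f U.

Definition kpotential (E : set (R3 R)) (k : R) l : R3 R -> R :=
  xget (fun _ => 0) (is_kpotential E k l).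

Definition kpotential_exists_unique (E : set (R3 R)) (k : R) :=
  forall l, dual_dirichlet l ->
    (exists U, is_kpotential E k l U) /\
    (forall U V, is_kpotential E k l U -> is_kpotential E k l V ->
       {ae mu, forall x, U x = V x}).

Definition kenergy (E : set (R3 R)) (k : R) l : R :=
  dvalue l (kpotential E k l).

End dirichlet_class.

(* Main.v *)
(* The k-energy is the square of a Hilbert-type seminorm: if U and U' are the
   k-potentials of l and l', the midpoint of l and l' lies in Ch(E, q) and has
   energy (W(l) + W(l')) / 2 - (U - U', U - U')_k / 4.  Since k <= k(E) makes
   (.,.)_k positive semidefinite, this gives uniqueness at once, because
   |l(phi) - l'(phi)|^2 <= (phi, phi)_k (U - U', U - U')_k by Cauchy-Schwarz.
   It also shows that the potentials U_n of a minimizing sequence l_n are Cauchy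
   for (.,.)_k, so l_n(phi) = (phi, U_n)_k converges for every phi.  The limit l
   satisfies l(phi)^2 <= m (phi, phi)_k with m the infimum, hence is continuous
   for the Dirichlet norm; the support condition and l(1) = q (computed with one
   cutoff function) pass to the limit.  Taking phi = U_k^l gives
   W(l)^2 <= m W(l), so l is a minimizer.  Coercivity of (.,.)_k is never used. *)

(* Completeness of the Dirichlet class for [(.,.)_k] is never established, so the Cauchy sequence of
   potentials is given no limit. The limit is taken of the numbers [(phi, U_n)_k] only, and the
   potential of the limit distribution is then supplied by the standing assumption. That assumption
   speaks only of members of [D^*], which is why each functional built on the way must be bounded by
   the Dirichlet norm; the bound comes from Cauchy-Schwarz and [(f, f)_k <= ||f||^2 / (4 pi)]. The
   obstacle is that the objects are given by choices or by intersections: a gradient is one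
   representative among many, [l(1)] is read off an arbitrary test function, and the support is an
   intersection of closed sets. Most of the work shows that these choices do not matter. For
   gradients this rests on integration by parts, for supports and [l(1)] on smooth cutoffs glued
   over compact sets. *)
From HB Require Import structures.
Require Import Defs.
From mathcomp Require Import all_boot all_order all_algebra.
From mathcomp Require Import all_classical all_reals all_analysis.
From mathcomp Require Import measurable_realfun ring lra.
Import Order.TTheory GRing.Theory Num.Theory.
Import numFieldNormedType.Exports.
Local Open Scope classical_set_scope.
Local Open Scope ring_scope.

Set Implicit Arguments.
Unset Strict Implicit.
Unset Printing Implicit Defensive.

(** * The volume measure *)

Section volume.
Context {R : realType}.
Notation mu := (@volume R).

Lemma rat_near (x e : R) : 0 < e -> exists q : rat, `|x - ratr q| < e.
Proof.
move=> e0; have /rat_in_itvoo[q] : x - e < x + e by lra.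
by rewrite in_itv/= => /andP[? ?]; exists q; rewrite ltr_norml; apply/andP;
  split; lra.
Qed.

(** The sigma-algebra here is a product of Borel sigma-algebras, so openness must be reduced to
    products: an open set is the countable union of the rational cubes that it contains. *)
Lemma open_measurable3 (U : set (R3 R)) : open U -> measurable (U : set (mR3 R)).
Proof.
move=> oU.
pose B (p : rat * rat * rat * nat) : set (mR3 R) :=
  ball (ratr p.1.1.1 : R) (p.2.+1%:R^-1 : R)
  `*` ball (ratr p.1.1.2 : R) (p.2.+1%:R^-1 : R)
  `*` ball (ratr p.1.2 : R) (p.2.+1%:R^-1 : R).
have mB p : measurable (B p).
  by apply: measurableX; [apply: measurableX|]; rewrite ball_itv;
    exact: measurable_itv.
have -> : (U : set (mR3 R)) = \bigcup_p (if `[< B p `<=` U >] then B p else set0).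
  apply/seteqP; split => [[[x y] z] Ux|x [p _]];
    last by case: asboolP => // + Bx; apply.
  have /nbhs_ballP[e /= e0 eU] : nbhs ((x, y, z) : R3 R) U by exact: open_nbhs_nbhs.
  (* Half of [e], because the triangle inequality passes through the rational center, which is
     within the radius both of [(x, y, z)] and of any point of the cube. *)
  have [n n2] : exists n, n.+1%:R^-1 < e / 2.
    have [n] : exists n, (e / 2)^-1 < n%:R.
      exists (Num.bound (e / 2)^-1); apply: archi_boundP.
      by rewrite invr_ge0; lra.
    move=> h; exists n; rewrite invf_plt ?posrE//; last by lra.
    by rewrite (lt_trans h)// ltr_nat.
  have n0 : 0 < n.+1%:R^-1 :> R by rewrite invr_gt0 ltr0Sn.
  have [qx hx] := rat_near x n0; have [qy hy] := rat_near y n0.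
  have [qz hz] := rat_near z n0.
  exists (qx, qy, qz, n) => //.
  have Bxyz : B (qx, qy, qz, n) (x, y, z).
    by split; [split|]; rewrite /ball /= /ball_ distrC.
  rewrite asboolT// => -[[x' y'] z'] [[/= h1 h2] h3]; apply: eU.
  move: hx hy hz h1 h2 h3 n2; rewrite /ball /= /ball_ /prod_ball /= /ball /=.
  set d := _^-1 => hx hy hz h1 h2 h3 n2.
  by split; [split|]; rewrite /= /ball /=;
    apply: (le_lt_trans (ler_distD _ _ _)); rewrite (splitr e); apply: ltrD;
    apply: lt_trans n2; eassumption.
apply: countable_bigcupT_measurable; first exact: countableP.
by move=> p; case: ifP.
Qed.

Lemma closed_measurable3 (U : set (R3 R)) : closed U ->
  measurable (U : set (mR3 R)).
Proof.
by move=> cU; rewrite -[U]setCK; apply: measurableC; apply: open_measurable3;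
  exact: closed_openC.
Qed.

Lemma compact_measurable3 (K : set (R3 R)) : compact K ->
  measurable (K : set (mR3 R)).
Proof.
by move=> cK; apply: closed_measurable3; apply: compact_closed.
Qed.

Lemma continuous_measurable3 (f : R3 R -> R) : continuous f ->
  measurable_fun [set: mR3 R] f.
Proof.
move=> cf; apply: (measurability _ (RGenOpens.measurableE R)) =>
  _ [_ [a [b ->] <-]].
rewrite setTI; apply: open_measurable3.
by move/continuousP : cf; apply; exact: interval_open.
Qed.

Lemma compact_box (K : set (R3 R)) : compact K -> exists2 r : R, 0 < r &
  forall x y z, K (x, y, z) -> [/\ `|x| <= r, `|y| <= r & `|z| <= r].
Proof.
move=> /(@compact_bounded R (R * R * R)%type)[M [_ hM]].
exists (`|M| + 1); first by rewrite ltr_wpDl.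
move=> x y z Kx; have := hM (`|M| + 1) _ _ Kx.
rewrite ltr_pwDr// ?ler_norm// => /(_ isT).
move=> H; have : Num.max (Num.max `|x| `|y|) `|z| <= `|M| + 1 by exact: H.
rewrite !ge_max.
by move=> /andP[/andP[-> ->] ->].
Qed.

Definition box (r : R) : set (R3 R) := `[-r, r] `*` `[-r, r] `*` `[-r, r].

Lemma compact_box_set r : compact (box r).
Proof.
by apply: compact_setX; [apply: compact_setX|]; exact: segment_compact.
Qed.

Lemma compact_finite (K : set (R3 R)) : compact K -> (mu (K : set (mR3 R)) < +oo)%E.
Proof.
move=> cK; have [r r0 Kr] := compact_box cK.
apply: (@le_lt_trans _ _ (mu (box r : set (mR3 R)))).
  apply: le_measure; rewrite ?inE;
    [exact: compact_measurable3|exact: compact_measurable3 (@compact_box_set r)|].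
  by move=> [[x y] z] /Kr[]; rewrite !ler_norml => *; split; [split|];
    rewrite /= in_itv.
rewrite /volume/= product_measure1E; [|by apply: measurableX;
  exact: measurable_itv|exact: measurable_itv].
rewrite /= product_measure1E; [|exact: measurable_itv|exact: measurable_itv].
have fI : lebesgue_measure `[- r, r]%classic \is a fin_num.
  by rewrite lebesgue_measure_itv/= lte_fin; case: ifP => _; rewrite -?EFinD.
by rewrite ltey_eq; apply/orP; left; apply: fin_numM; [apply: fin_numM|]; exact: fI.
Qed.

End volume.

(** * Semi-inner products and L2 *)

Section semi_inner_product.
Context {R : realType} {V : lmodType R}.
Implicit Types (D : V -> Prop) (B : V -> V -> R).

(** The domain is a predicate and positivity is only semidefinite because functions are not
    identified almost everywhere. The same lemmas then serve the L2 product, the Dirichlet form and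
    the k-form. *)
Record semi_inner D B : Prop := SemiInner {
  si_lin : forall a u v, D u -> D v -> D (a *: u + v) ;
  si_sym : forall u v, B u v = B v u ;
  si_linl : forall a u v w, D u -> D v -> D w ->
    B (a *: u + v) w = a * B u w + B v w ;
  si_ge0 : forall u, D u -> 0 <= B u u }.

Section theory.
Context {D B} (h : semi_inner D B).

Lemma si_linr a u v w : D u -> D v -> D w ->
  B w (a *: u + v) = a * B w u + B w v.
Proof. by move=> Du Dv Dw; rewrite (si_sym h) (si_linl h)// !(si_sym h _ w). Qed.

Lemma si_quad a u v : D u -> D v ->
  B (a *: u + v) (a *: u + v) = a ^+ 2 * B u u + 2 * a * B u v + B v v.
Proof.
move=> Du Dv; have Dw := si_lin h a Du Dv.
by rewrite (si_linl h)// !si_linr// (si_sym h v u); ring.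
Qed.

Lemma si_B u v : D u -> D v -> D (u - v).
Proof.
by move=> Du Dv; have := si_lin h (-1) Dv Du; rewrite scaleN1r addrC.
Qed.

Lemma si_linBl u v w : D u -> D v -> D w -> B (u - v) w = B u w - B v w.
Proof.
move=> Du Dv Dw; have -> : u - v = -1 *: v + u by rewrite scaleN1r addrC.
by rewrite (si_linl h)//; ring.
Qed.

Lemma si_quadB u v : D u -> D v -> B (u - v) (u - v) = B u u - 2 * B u v + B v v.
Proof.
move=> Du Dv; have -> : u - v = -1 *: v + u by rewrite scaleN1r addrC.
by rewrite si_quad// (si_sym h v u); ring.
Qed.

Lemma si_CS u v : D u -> D v -> B u v ^+ 2 <= B u u * B v v.
Proof.
move=> Du Dv.
have q a : 0 <= a ^+ 2 * B u u + 2 * a * B u v + B v v.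
  by rewrite -si_quad//; apply: (si_ge0 h); exact: (si_lin h).
have [u0|u0] := eqVneq (B u u) 0.
  have q' a : 0 <= 2 * a * B u v + B v v by have := q a; rewrite u0 mulr0 add0r.
  have [->|uv0] := eqVneq (B u v) 0; first by rewrite u0 mul0r expr0n.
  (* When [B u u = 0] the quadratic is affine in [a]; a nonzero slope would let it take the value -1
     at this point. *)
  have := q' (- (B v v + 1) / (2 * B u v)).
  rewrite (_ : 2 * (- (B v v + 1) / (2 * B u v)) * B u v = - (B v v + 1));
    last by field.
  lra.
have := q (- B u v / B u u).
rewrite (_ : _ + _ + _ = (B u u * B v v - B u v ^+ 2) / B u u); last by field.
by rewrite pmulr_lge0 ?subr_ge0// invr_gt0 lt_neqAle eq_sym u0 (si_ge0 h).
Qed.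

End theory.
End semi_inner_product.

Section L2.
Context d (T : measurableType d) {R : realType}.
Variables (mu : {measure set T -> \bar R}) (A : set T).
Hypothesis mA : measurable A.
Implicit Types f g : T -> R.

Definition L2 f := measurable_fun A f /\ (\int[mu]_(x in A) ((f x) ^+ 2)%:E <
  +oo)%E.

Definition ip f g : R := \int[mu]_(x in A) (f x * g x).

Lemma L2_integrable f g : L2 f -> L2 g ->
  mu.-integrable A (EFin \o (fun x => f x * g x)).
Proof.
move=> [mf f2] [mg g2]; apply/integrableP; split.
  by apply/measurable_EFinP; exact: measurable_funM.
have msq (h : T -> R) : measurable_fun A h ->
  measurable_fun A (fun x => ((h x) ^+ 2)%:E).
  by move=> mh; apply/measurable_EFinP; exact: measurable_funX.
apply: (@le_lt_trans _ _ (\int[mu]_(x in A) ((f x ^+ 2)%:E + (g x ^+ 2)%:E))%E).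
  apply: ge0_le_integral => //.
  - apply: measurableT_comp => //.
    by apply/measurable_EFinP; exact: measurable_funM.
  - by apply: emeasurable_funD; exact: msq.
  - move=> x _; rewrite /= lee_fin normrM -(real_normK (num_real (f x))).
    rewrite -(real_normK (num_real (g x))).
    have := normr_ge0 (f x); have := normr_ge0 (g x).
    have := sqr_ge0 (`|f x| - `|g x|); nra.
rewrite ge0_integralD//; first exact: lte_add_pinfty.
- by move=> x _; rewrite lee_fin sqr_ge0.
- exact: msq.
- by move=> x _; rewrite lee_fin sqr_ge0.
- exact: msq.
Qed.

Lemma ip_self f : L2 f -> (ip f f)%:E = (\int[mu]_(x in A) ((f x) ^+ 2)%:E)%E.
Proof.
move=> Lf; rewrite /ip /Rintegral fineK; last first.
  by apply: integrable_fin_num => //; exact: L2_integrable.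
by apply: eq_integral => x _; rewrite expr2.
Qed.

(** Measurability alone is assumed and the integrals may be infinite, so the bound also applies to
    differences [f_ n - f] that are not yet known to be square integrable. *)
Lemma integral_sqr_lin a f g : measurable_fun A f -> measurable_fun A g ->
  (\int[mu]_(x in A) (((a *: f + g) x) ^+ 2)%:E <=
   (2 * a ^+ 2)%:E * \int[mu]_(x in A) ((f x) ^+ 2)%:E +
   2%:E * \int[mu]_(x in A) ((g x) ^+ 2)%:E)%E.
Proof.
move=> mf mg.
have msq (h : T -> R) : measurable_fun A h ->
  measurable_fun A (fun x => ((h x) ^+ 2)%:E).
  by move=> mh; apply/measurable_EFinP; exact: measurable_funX.
have maf : measurable_fun A (fun x => a * f x) by apply: measurable_funM.
have mafg : measurable_fun A (a *: f + g) by exact: measurable_funD.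
apply: (@le_trans _ _ (\int[mu]_(x in A)
    ((2 * a ^+ 2)%:E * (f x ^+ 2)%:E + 2%:E * (g x ^+ 2)%:E))%E).
  apply: ge0_le_integral => //.
  - by move=> x _; rewrite lee_fin sqr_ge0.
  - exact: msq.
  - by apply: emeasurable_funD; apply: emeasurable_funM => //; exact: msq.
  - move=> x _; rewrite -!EFinM -EFinD lee_fin /= !fctE.
    have := sqr_ge0 (a * f x - g x); rewrite /GRing.scale/=; nra.
have h (c : R) (u : T -> R) : 0 <= c -> forall x, A x ->
  (0 <= c%:E * (u x ^+ 2)%:E)%E.
  by move=> c0 x _; rewrite -EFinM lee_fin mulr_ge0 ?sqr_ge0.
rewrite ge0_integralD//; last 4 first.
- by apply: h; rewrite mulr_ge0 ?sqr_ge0.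
- by apply: emeasurable_funM => //; exact: msq.
- exact: h.
- by apply: emeasurable_funM => //; exact: msq.
have Z (c : R) (u : T -> R) : 0 <= c -> measurable_fun A u ->
    (\int[mu]_(x in A) (c%:E * (u x ^+ 2)%:E) = c%:E * \int[mu]_(x in A) (u x ^+
      2)%:E)%E.
  move=> c0 mu'; apply: ge0_integralZl_EFin => //; last exact: msq.
  by move=> x _; rewrite lee_fin sqr_ge0.
have a2 : 0 <= 2 * a ^+ 2 by rewrite mulr_ge0 ?sqr_ge0.
by rewrite !Z.
Qed.

Lemma L2_lin a f g : L2 f -> L2 g -> L2 (a *: f + g).
Proof.
move=> [mf f2] [mg g2].
have maf : measurable_fun A (fun x => a * f x) by apply: measurable_funM.
split; first exact: measurable_funD.
apply: (le_lt_trans (integral_sqr_lin _ mf mg)).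
have a2 : 0 <= 2 * a ^+ 2 by rewrite mulr_ge0 ?sqr_ge0.
by apply: lte_add_pinfty; apply: lte_mul_pinfty => //; rewrite lee_fin.
Qed.

Lemma semi_inner_ip : semi_inner L2 ip.
Proof.
split.
- exact: L2_lin.
- by move=> f g; apply: eq_Rintegral => x _; rewrite mulrC.
- move=> a f g h Lf Lg Lh; rewrite /ip.
  transitivity (\int[mu]_(x in A) (a * (f x * h x) + g x * h x)).
    by apply: eq_Rintegral => x _; rewrite !fctE /GRing.scale/=; ring.
  rewrite RintegralD// ?RintegralZl//; try exact: L2_integrable.
  have := integrableZl mA a (L2_integrable Lf Lh).
  exact.
- move=> f Lf; apply: Rintegral_ge0 => x _; exact: sqr_ge0.
Qed.

End L2.

(** * Smooth functions *)

Section calculus.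
Context {R : realType}.
Implicit Types (f g : R3 R -> R) (i : 'I_3) (s : seq 'I_3) (x : R3 R).

Lemma smooth_continuous f : smooth f -> continuous f.
Proof. by move=> /(_ [::])[]. Qed.

Lemma smooth_derivable f i x : smooth f -> derivable f x (unit_vec i).
Proof. by move=> /(_ [::])[_]; apply. Qed.

Lemma smooth_partial f i : smooth f -> smooth (partial i f).
Proof.
move=> sf s; rewrite (_ : partials s _ = partials (rcons s i) f); first exact: sf.
by rewrite /partials -cats1 foldr_cat.
Qed.

(* To control all iterated partials at once, it is enough that the partials of the
   generators stay in the algebra they generate. *)
Section generated_algebra.
Variable G : (R3 R -> R) -> Prop.

Inductive alg_gen : (R3 R -> R) -> Prop :=
| alg_gen_base f : G f -> alg_gen f
| alg_gen_add f g : alg_gen f -> alg_gen g -> alg_gen (f + g)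
| alg_gen_mul f g : alg_gen f -> alg_gen g -> alg_gen (f * g).

Hypothesis G_partial : forall f, G f -> continuous f /\
  forall i, (forall x, derivable f x (unit_vec i)) /\ alg_gen (partial i f).

Lemma alg_gen_smooth f : alg_gen f -> smooth f.
Proof.
have alg_partial g : alg_gen g -> continuous g /\
    forall i, (forall x, derivable g x (unit_vec i)) /\ alg_gen (partial i g).
  elim=> {g} [g /G_partial//|g h ag [cg dg] ah [ch dh]|g h ag [cg dg] ah [ch dh]].
  - split=> [x|i]; first by apply: cvgD; [exact: cg|exact: ch].
    split=> [x|]; first by apply: derivableD; [exact: (dg i).1|exact: (dh i).1].
    rewrite (_ : partial i _ = partial i g + partial i h).
      by apply: alg_gen_add; [exact: (dg i).2|exact: (dh i).2].
    apply/funext => x; rewrite /partial deriveD//;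
      [exact: (dg i).1|exact: (dh i).1].
  - split=> [x|i]; first by apply: cvgM; [exact: cg|exact: ch].
    split=> [x|]; first by apply: derivableM; [exact: (dg i).1|exact: (dh i).1].
    rewrite (_ : partial i _ = g * partial i h + h * partial i g).
      by apply: alg_gen_add; apply: alg_gen_mul => //;
        [exact: (dh i).2|exact: (dg i).2].
    apply/funext => x; rewrite /partial deriveM//;
      [exact: (dg i).1|exact: (dh i).1].
move=> af s.
suff /alg_partial[cf df] : alg_gen (partials s f).
  by split=> // i x; exact: (df i).1.
by elim: s => [//|i s /alg_partial[_ /(_ i)[]]].
Qed.

End generated_algebra.

Lemma smoothM f g : smooth f -> smooth g -> smooth (f * g).
Proof.
move=> sf sg; apply: (@alg_gen_smooth smooth); last first.
  by apply: alg_gen_mul; exact: alg_gen_base.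
move=> h sh; split; first exact: smooth_continuous.
move=> i; split=> [x|]; first exact: smooth_derivable.
exact/alg_gen_base/smooth_partial.
Qed.

Lemma smooth0 : smooth (0 : R3 R -> R).
Proof.
move=> s; rewrite partials0; split=> [x|i x]; first exact: cst_continuous.
exact: derivable_cst.
Qed.

Lemma smooth_cst (c : R) : smooth (cst c : R3 R -> R).
Proof.
apply: (@alg_gen_smooth (fun f => exists c, f = cst c)); last first.
  by apply: alg_gen_base; exists c.
move=> _ [{}c ->]; split; first exact: cst_continuous.
move=> i; split=> [x|]; first exact: derivable_cst.
apply: alg_gen_base; exists 0; apply/funext => x.
by rewrite /partial derive_cst.
Qed.

Lemma smoothD f g : smooth f -> smooth g -> smooth (f + g).
Proof. by move=> sf sg; rewrite -[f]scale1r; exact: smooth_lin. Qed.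

Lemma smoothB f g : smooth f -> smooth g -> smooth (f - g).
Proof. by move=> sf sg; rewrite addrC -scaleN1r; exact: smooth_lin. Qed.

(** The derivative of [1/f] is [- f' (1/f)^2], so the algebra generated by [1/f] and the smooth
    functions is stable under partials. *)
Lemma smoothV f : smooth f -> (forall x, f x != 0) -> smooth (fun x => (f x)^-1).
Proof.
move=> sf f0.
apply: (@alg_gen_smooth (fun g => smooth g \/ g = (fun x => (f x)^-1))); last first.
  by apply: alg_gen_base; right.
move=> g [sg|->].
  split; first exact: smooth_continuous.
  move=> i; split=> [x|]; first exact: smooth_derivable.
  by apply: alg_gen_base; left; exact: smooth_partial.
split=> [x|i]; first by apply: cvgV; [exact: f0|exact: smooth_continuous].
split=> [x|]; first by apply: derivableV; [exact: f0|exact: smooth_derivable].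
rewrite (_ : partial i _ = (cst (-1) * partial i f) *
    ((fun x => (f x)^-1) * (fun x => (f x)^-1))).
  apply: alg_gen_mul; first by apply/alg_gen_base; left; apply: smoothM;
    [exact: smooth_cst|exact: smooth_partial].
  by apply: alg_gen_mul; apply: alg_gen_base; right.
apply/funext => x; rewrite /partial deriveV//; last exact: smooth_derivable.
rewrite !fctE /GRing.scale/= -exprVn expr2; ring.
Qed.

End calculus.

(** * The flat function exp(-1/t) and its derivatives *)

Section flat.
Context {R : realType}.

(** For positive [n], this is [1 + t <= expR t] at [t = y / n], raised to the power [n]. *)
Lemma expR_ge_pow n (y : R) : 0 <= y -> y ^+ n <= n%:R ^+ n * expR y.
Proof.
move=> y0; case: n => [|n];
  first by rewrite !expr0 mul1r (le_trans _ (expR_ge1Dx y))// lerDl.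
have n0 : n.+1%:R != 0 :> R by rewrite pnatr_eq0.
have -> : expR y = expR (y / n.+1%:R) ^+ n.+1.
  by rewrite -expRM_natl mulrC divfK.
have h : y <= n.+1%:R * expR (y / n.+1%:R).
  by rewrite -ler_pdivrMl ?ltr0Sn// [leLHS]mulrC (le_trans _ (expR_ge1Dx _))//
    lerDr.
by rewrite -exprMn; apply: lerXn2r; rewrite ?nnegrE// (le_trans y0).
Qed.

(** The power of [1/t] is kept as an index because differentiation sends [flat n] to a combination
    of [flat n.+2] and [flat n.+1]: the family is closed up to linear combinations. *)
Definition flat n (t : R) := if 0 < t then t^-1 ^+ n * expR (- t^-1) else 0.

(** A quadratic bound makes the difference quotient at 0 tend to 0, which settles the only delicate
    point of [is_derive_flat]. It is [expR_ge_pow] with exponent [n.+2] at [t^-1]. *)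
Lemma flat_le n (t : R) : 0 <= flat n t <= (n.+2)%:R ^+ n.+2 * t ^+ 2.
Proof.
rewrite /flat; case: ifPn => [t0|_]; last by rewrite lexx/=; apply: mulr_ge0;
  [apply: exprn_ge0|apply: sqr_ge0].
have ti0 : 0 < t^-1 by rewrite invr_gt0.
have e0 := expR_gt0 (- t^-1).
apply/andP; split; first by rewrite mulr_ge0 ?exprn_ge0 ?ltW.
have := expR_ge_pow n.+2 (ltW ti0).
have -> : expR t^-1 = (expR (- t^-1))^-1 by rewrite expRN invrK.
rewrite ler_pdivlMr//; move: (n.+2%:R ^+ n.+2) => N h.
have -> : t ^+ 2 = (t^-1 ^+ 2)^-1 by rewrite exprVn invrK.
rewrite ler_pdivlMr ?exprn_gt0//.
by rewrite mulrAC -exprD addn2.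
Qed.

Lemma is_derive_flat n (t : R) :
  is_derive t 1 (flat n) (flat n.+2 t - n%:R * flat n.+1 t).
Proof.
have [t0|t0|->] := ltgtP t 0.
- have e : \forall s \near t, cst 0 s = flat n s.
    near=> s; rewrite /flat ifF//; apply/negbTE; rewrite -leNgt.
    by apply: ltW; near: s; apply: open_nbhs_nbhs; split; [exact: open_lt|].
  have -> : flat n.+2 t - n%:R * flat n.+1 t = 0.
    by rewrite /flat !ifF ?mulr0 ?subr0//; apply/negbTE; rewrite -leNgt ltW.
  split; first by apply: near_eq_derivable e _; exact: derivable_cst.
  by rewrite -(near_eq_derive _ e) derive_cst.
- have e : \forall s \near t, (s^-1 ^+ n * expR (- s^-1)) = flat n s.
    near=> s; rewrite /flat ifT//.
    by near: s; apply: open_nbhs_nbhs; split; [exact: open_gt|].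
  have tn0 : t != 0 by rewrite gt_eqF.
  have d : is_derive t 1 (fun s =>
    s^-1 ^+ n * expR (- s^-1)) (flat n.+2 t - n%:R * flat n.+1 t).
    have dV : is_derive t 1 (fun s : R => s^-1) (- t ^- 2).
      by have := @is_deriveV R id t 1 1 tn0 (is_derive_id _ _);
        rewrite /GRing.scale/= mulr1.
    have dn := is_deriveX n dV.
    have dNV : is_derive t 1 (fun s : R => - s^-1) (t ^- 2).
      by have := is_deriveN dV; rewrite opprK.
    have de := @is_derive1_comp R expR (fun s =>
      - s^-1) t _ _ (is_derive_expR (- t^-1)) dNV.
    rewrite (_ : (fun s => _) = (fun s : R => s^-1) ^+ n * (expR \o (fun s =>
      - s^-1))); last first.
      by apply/funext => s; rewrite !fctE.
    apply: is_derive_eq (is_deriveM dn de) _.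
    rewrite /flat t0 /GRing.scale/= !fctE -!exprVn.
    by case: n {e dn} => [|n] /=; rewrite ?exprS ?expr0; ring.
  case: d => d1 d2; split; first by apply: near_eq_derivable e _.
  by rewrite -(near_eq_derive _ e).
- have c0 : (h^-1 *: ((flat n \o shift 0) (h *: (1 :
  R)) - flat n 0)) @[h --> (0:R)^'] --> (0 : R).
    apply/cvgrPdist_le => /= e e0.
    have C0 : 0 < (n.+2)%:R ^+ n.+2 :> R by rewrite exprn_gt0// ltr0Sn.
    near=> h; rewrite sub0r normrN /= addr0 /flat ltxx subr0 -/(flat n _).
    rewrite /GRing.scale/= mulr1 normrM.
    have h0 : h != 0 by near: h; exact: nbhs_dnbhs_neq.
    have hn0 : 0 < `|h| by rewrite normr_gt0.
    have /andP[f0 fle] := flat_le n h.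
    rewrite (ger0_norm f0) normfV ler_pdivrMl//.
    apply: (le_trans fle); rewrite -real_normK ?num_real// expr2 mulrCA ler_pM2l//.
    rewrite mulrC -ler_pdivlMr//.
    near: h; apply: dnbhs0_le; exact: divr_gt0.
  have -> : flat n.+2 (0 :
    R) - n%:R * flat n.+1 0 = 0 by rewrite /flat ltxx mulr0 subr0.
  split; first by apply: cvgP c0.
  exact: cvg_lim c0.
Unshelve. all: by end_near. Qed.

End flat.

(** If [P K] fails, the sets whose complement in [K] satisfies [P] form a proper filter. It clusters
    at some [x] in [K], yet the complement of a neighborhood of [x] satisfying [P] belongs to it, a
    contradiction. This replaces partitions of unity when local constructions are glued. *)
Lemma compact_ind (T : topologicalType) (K : set T) (P : set T -> Prop) :
  compact K -> P set0 -> (forall A B, P A -> P B -> P (A `|` B)) ->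
  (forall A B, A `<=` B -> P B -> P A) ->
  (forall x, K x -> exists2 U, nbhs x U & P U) -> P K.
Proof.
move=> cK P0 PU PS Ploc; apply: contrapT => nPK.
pose F : set_system T := [set A | P (K `\` A)].
have FF : ProperFilter F.
  split; first by rewrite /F /= setD0.
  split; first by rewrite /F /= setDT.
  - by move=> A B FA FB; rewrite /F /= setDIr; exact: PU.
  - by move=> A B AB; apply: PS => x [Kx nBx]; split=> // /AB.
have [|x [Kx]] := cK F FF; first by rewrite /F /= setDv.
have [U xU PU'] := Ploc _ Kx.
move=> /(_ (~` U) U _ xU)[|y []//].
by apply: PS PU' => y [_ /contrapT].
Qed.

(** * Bump functions on 3-space *)

Section bump.
Context {R : realType}.
Implicit Types (f g : R3 R -> R) (i : 'I_3) (x a : R3 R).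

Definition coord i x : R :=
  if (i == 0 :> nat)%N then x.1.1 else if (i == 1 :> nat)%N then x.1.2 else x.2.

Lemma coord_line i j (t : R) x :
  coord i (t *: unit_vec j + x) = (i == j)%:R * t + coord i x.
Proof.
have -> : (i == j) = (i == j :> nat) by [].
case: i => [[|[|[|i]]] hi]; case: j => [[|[|[|j]]] hj];
  rewrite //= /coord /unit_vec /=;
  by rewrite /GRing.scale/= ?mulr1 ?mulr0 ?mul1r ?mul0r.
Qed.

Lemma continuous_coord i : continuous (coord i).
Proof.
rewrite /coord; case: (_ == 0 :> nat)%N => x.
  by apply: (@continuous_comp _ _ _ (fun x : R3 R => x.1) fst); exact: cvg_fst.
case: (_ == 1 :> nat)%N; last exact: cvg_snd.
by apply: (@continuous_comp _ _ _ (fun x : R3 R => x.1) snd);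
  [exact: cvg_fst|exact: cvg_snd].
Qed.

(** On a line parallel to an axis, [coord i] is affine in the parameter, so the one-variable chain
    rule at parameter 0 is enough. *)
Lemma is_derive_coord (u : R -> R) (u' : R) i j (c d : R) x :
  is_derive (c * coord i x + d) 1 u u' ->
  is_derive x (unit_vec j) (fun y => u (c * coord i y + d)) (c * (i == j)%:R * u').
Proof.
move=> du.
have aff : is_derive (0 : R) 1 (fun t : R =>
  (c * (i == j)%:R) * t + (c * coord i x + d)) (c * (i == j)%:R).
  apply: is_derive_eq.
  by rewrite /GRing.scale/= mulr1 addr0.
have := @is_derive1_comp R u _ 0 _ _ _ aff.
rewrite mulr0 add0r => /(_ _ du)[d1 d2].
have e : (u \o (fun t : R => c * (i == j)%:R * t + (c * coord i x + d))) =
    (fun h : R => u (c * coord i (h *: unit_vec j + x) + d)).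
  by apply/funext => t /=; rewrite coord_line; congr u; ring.
split; first by apply/derivable1P; rewrite -e.
rewrite [RHS]mulrC -d2 /derive /=.
congr (lim (_ @ 0^')); apply/funext => h /=.
rewrite coord_line /GRing.scale/= mulr1 addr0 mulr0 add0r; congr (_ * (u _ - _));
  ring.
Qed.

Lemma smooth_flat_coord n (c d : R) i :
  smooth (fun x => flat n (c * coord i x + d)).
Proof.
pose G f := (exists n, f = (fun x =>
  flat n (c * coord i x + d))) \/ (exists e, f = cst e).
apply: (@alg_gen_smooth _ G); last by apply: alg_gen_base; left; exists n.
move=> f [[{}n ->]|[e ->]].
  split=> [x|j].
    apply: (@continuous_comp _ _ _ (fun x => c * coord i x + d) (flat n)).
      by apply: cvgD; [apply: cvgMr; exact: continuous_coord|exact: cvg_cst].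
    apply: differentiable_continuous; apply/derivable1_diffP.
    by case: (is_derive_flat n (c * coord i x + d)).
  have dF x := is_derive_coord j (is_derive_flat n (c * coord i x + d)).
  split=> [x|]; first by case: (dF x).
  rewrite (_ : partial j _ = cst (c * (i == j)%:R) *
    ((fun x => flat n.+2 (c * coord i x + d)) +
     cst (- n%:R) * (fun x => flat n.+1 (c * coord i x + d)))); last first.
    apply/funext => x; rewrite /partial; case: (dF x) => _ ->; rewrite !fctE; ring.
  apply: alg_gen_mul; first by apply: alg_gen_base; right; eexists.
  apply: alg_gen_add; first by apply: alg_gen_base; left; exists n.+2.
  apply: alg_gen_mul; first by apply: alg_gen_base; right; eexists.
  by apply: alg_gen_base; left; exists n.+1.
split; first exact: cst_continuous.
move=> j; split=> [x|]; first exact: derivable_cst.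
apply: alg_gen_base; right; exists 0; apply/funext => x.
by rewrite /partial derive_cst.
Qed.

Definition step (t : R) := flat 0 t / (flat 0 t + flat 0 (1 - t)).

Lemma flat_gt0 n (t : R) : 0 < t -> 0 < flat n t.
Proof. by move=> t0; rewrite /flat t0 mulr_gt0 ?exprn_gt0 ?invr_gt0 ?expR_gt0. Qed.

Lemma flat_eq0 n (t : R) : t <= 0 -> flat n t = 0.
Proof. by move=> t0; rewrite /flat ltNge t0. Qed.

Lemma step_den (t : R) : flat 0 t + flat 0 (1 - t) != 0.
Proof.
have /andP[h1 _] := flat_le 0 t; have /andP[h2 _] := flat_le 0 (1 - t).
have [t0|t0] := ltP 0 t; first by have := flat_gt0 0 t0; lra.
have : 0 < 1 - t by lra.
by move=> /(flat_gt0 0); lra.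
Qed.

Lemma step0 (t : R) : t <= 0 -> step t = 0.
Proof. by move=> t0; rewrite /step (flat_eq0 _ t0) mul0r. Qed.

Lemma step1 (t : R) : 1 <= t -> step t = 1.
Proof.
move=> t1; have := step_den t; rewrite /step (@flat_eq0 _ (1 - t)) ?addr0;
  last by lra.
by move=> h; rewrite divff.
Qed.

Lemma smooth_step_coord (c d : R) i : smooth (fun x => step (c * coord i x + d)).
Proof.
have -> : (fun x => step (c * coord i x + d)) =
    (fun x => flat 0 (c * coord i x + d)) *
    (fun x => ((fun x => flat 0 (c * coord i x + d)) x +
               (fun x => flat 0 ((- c) * coord i x + (1 - d))) x)^-1).
  by apply/funext => x; rewrite !fctE /step; congr (_ / (_ + flat 0 _)); ring.
apply: smoothM; first exact: smooth_flat_coord.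
apply: smoothV; first by apply: smoothD; exact: smooth_flat_coord.
move=> x; rewrite (_ : - c * _ + _ = 1 - (c * coord i x + d)); last by ring.
exact: step_den.
Qed.

(** With [s = (x_i - a_i) / r] the two factors are [step (2 + s)] and [step (2 - s)]: both are 1 for
    [|s| <= 1] and one vanishes for [|s| >= 2]. The arguments are expanded into the affine form
    expected by [smooth_step_coord]. *)
Definition plateau a (r : R) x :=
  \prod_i (step (r^-1 * coord i x + (2 - r^-1 * coord i a)) *
           step ((- r^-1) * coord i x + (2 + r^-1 * coord i a))).

Lemma smooth_plateau a r : smooth (plateau a r).
Proof.
rewrite (_ : plateau a r = \prod_i (
    (fun x => step (r^-1 * coord i x + (2 - r^-1 * coord i a))) *
    (fun x => step ((- r^-1) * coord i x + (2 + r^-1 * coord i a))))); last first.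
  by apply/funext => x; rewrite /plateau fct_prodE.
elim/big_ind: _ => [|f g|i _]; [exact: smooth_cst|exact: smoothM|].
by apply: smoothM; exact: smooth_step_coord.
Qed.

Lemma plateau1 a r x : 0 < r -> (forall i, `|coord i x - coord i a| <= r) ->
  plateau a r x = 1.
Proof.
move=> r0 h; rewrite /plateau big1// => i _.
have rr : r^-1 * r = 1 by rewrite mulVf ?gt_eqF.
have ri : 0 < r^-1 by rewrite invr_gt0.
have := h i; rewrite ler_norml => /andP[h1 h2].
by rewrite !step1 ?mulr1//; nra.
Qed.

Lemma plateau_neq0 a r x i : 0 < r -> plateau a r x != 0 ->
  `|coord i x - coord i a| <= 2 * r.
Proof.
move=> r0; apply: contraNT; rewrite -ltNge => h.
rewrite /plateau (bigD1 i)//=.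
have rr : r^-1 * r = 1 by rewrite mulVf ?gt_eqF.
have ri : 0 < r^-1 by rewrite invr_gt0.
move: h; rewrite lter_normr => /orP[h|h].
  by rewrite [X in _ * X * _]step0 ?mulr0 ?mul0r//; nra.
by rewrite step0 ?mul0r//; nra.
Qed.

End bump.

(** * Cutoffs and supports of generalized functions *)

Section cutoff.
Context {R : realType}.
Implicit Types (f g : R3 R -> R) (i : 'I_3) (x a : R3 R) (phi psi : test R).

Lemma fun_suppP f (K : set (R3 R)) : closed K -> (forall x, f x != 0 -> K x) ->
  fun_supp f `<=` K.
Proof. by move=> cK h; rewrite /fun_supp closureE; apply: smallest_sub. Qed.

Lemma fun_supp_out f x : ~ fun_supp f x -> f x = 0.
Proof. by move=> h; apply/eqP; apply: contrapT => /negP fx; apply: h;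
  exact: subset_closure. Qed.

Lemma fun_supp_partial i f : fun_supp (partial i f) `<=` fun_supp f.
Proof.
apply: fun_suppP; first exact: closed_closure.
move=> x; apply: contraNP => nx; apply/eqP; rewrite /partial.
have : \forall y \near x, f y = 0.
  have : nbhs x (~` fun_supp f).
    by apply: open_nbhs_nbhs; split=> //; apply: closed_openC;
      exact: closed_closure.
  by apply: filterS => y; exact: fun_supp_out.
move=> /(@near_eq_derive _ _ _ f (cst 0)) => ->.
by rewrite derive_cst.
Qed.

Lemma is_testS f (K : set (R3 R)) : smooth f -> compact K -> fun_supp f `<=` K ->
  is_test f.
Proof.
by move=> sf cK fK; split=> //; apply: subclosed_compact cK fK;
  exact: closed_closure.
Qed.

Definition mk_test f (tf : is_test f) : test R := Test (asboolT tf).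

Lemma testP phi : is_test phi.
Proof. by case: phi => f fP; exact/asboolP. Qed.

Lemma fun_suppMl f g : fun_supp (f * g) `<=` fun_supp f.
Proof.
apply: fun_suppP => [|x]; first exact: closed_closure.
by rewrite mulf_eq0 negb_or => /andP[fx _]; exact: subset_closure.
Qed.

Lemma fun_suppMr f g : fun_supp (f * g) `<=` fun_supp g.
Proof. by rewrite mulrC; exact: fun_suppMl. Qed.

Lemma is_testM f phi : smooth f -> is_test (f * phi).
Proof.
move=> sf; have [sphi cphi] := testP phi.
by apply: (is_testS _ cphi); [exact: smoothM|exact: fun_suppMr].
Qed.

Definition test_mul f phi (sf : smooth f) : test R := mk_test (is_testM phi sf).

Lemma bump (U : set (R3 R)) a : open U -> U a -> exists rho : R3 R -> R,
  [/\ is_test rho, fun_supp rho `<=` U & \forall x \near a, rho x = 1].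
Proof.
move=> oU Ua; have /nbhs_ballP[e /= e0 eU] : nbhs a U by exact: open_nbhs_nbhs.
(* The plateau lives within distance [2 * r = e / 2] of [a], so even its closed support stays inside
   the open ball of radius [e]. *)
pose r := e / 4; have r0 : 0 < r by rewrite divr_gt0.
pose K : set (R3 R) := `[a.1.1 - 2 * r, a.1.1 + 2 * r]
  `*` `[a.1.2 - 2 * r, a.1.2 + 2 * r]
  `*` `[a.2 - 2 * r, a.2 + 2 * r].
have cK : compact K.
  by apply: compact_setX; [apply: compact_setX|]; exact: segment_compact.
have suppK : fun_supp (plateau a r) `<=` K.
  apply: fun_suppP; first by apply: compact_closed.
  move=> x px; split; [split|]; rewrite /= in_itv/=.
  - have := plateau_neq0 (inord 0) r0 px.
    by rewrite /coord inordK//= ler_distl.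
  - have := plateau_neq0 (inord 1) r0 px.
    by rewrite /coord inordK//= ler_distl.
  - have := plateau_neq0 (inord 2) r0 px.
    by rewrite /coord inordK//= ler_distl.
exists (plateau a r); split.
- by apply: is_testS cK suppK; exact: smooth_plateau.
- move=> x /suppK[[/=]]; rewrite !in_itv/= -!ler_distl => h1 h2 h3; apply: eU.
  have r2 : 2 * r < e by rewrite /r; lra.
  split; [split|]; rewrite /ball /= distrC; exact: le_lt_trans r2.
- have : nbhs a (ball a r) by exact: nbhsx_ballx.
  apply: filterS => x [[]]; rewrite /ball /= => h1 h2 h3.
  apply: plateau1 => // i; rewrite /coord distrC.
  by case: ifP => _; [|case: ifP => _]; exact: ltW.
Qed.

(** Equality with 1 is required on an open neighborhood [V] of [K], not just on [K], because
    [cvalue] compares functions near the support. *)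
Lemma cutoff (K U : set (R3 R)) : compact K -> open U -> K `<=` U ->
  exists chi : test R, fun_supp chi `<=` U /\
    exists V, [/\ open V, K `<=` V & {in V, chi =1 cst 1}].
Proof.
move=> cK oU KU.
apply: (compact_ind (P := fun K => exists chi : test R, fun_supp chi `<=` U /\
    exists V, [/\ open V, K `<=` V & {in V, chi =1 cst 1}]) cK).
- exists 0; split.
    rewrite /fun_supp (_ : [set _ | _] = set0) ?closure0//.
    by apply/seteqP; split=> x //=; rewrite eqxx.
  by exists set0; split; [exact: open0|by []|move=> x; rewrite inE].
- move=> A B [c1 [c1U [V1 [oV1 AV1 c1V]]]] [c2 [c2U [V2 [oV2 BV2 c2V]]]].
  (* This is [1 - (1 - c1) (1 - c2)], equal to 1 wherever [c1] or [c2] is. *)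
  pose c := c1 + c2 - test_mul c2 (testP c1).1.
  exists c; split.
    apply: (@subset_trans _ (fun_supp c1 `|` fun_supp c2)); last by rewrite subUset.
    apply: fun_suppP; first by apply: closedU; exact: closed_closure.
    move=> x; apply: contraNP => /not_orP[/fun_supp_out h1 /fun_supp_out h2].
    by rewrite /c /= !fctE h1 h2 mul0r addr0 subr0.
  exists (V1 `|` V2); split; [exact: openU|exact: setUSS|].
  move=> x; rewrite inE /= => -[V1x|V2x]; rewrite /c /=.
    by rewrite !fctE c1V ?inE//=; ring.
  by rewrite !fctE c2V ?inE//=; ring.
- by move=> A B AB [chi [cU [V [oV BV cV]]]]; exists chi; split=> //; exists V;
  split=> //; exact: subset_trans BV.
- move=> x /KU Ux; have [rho [tr rU r1]] := bump oU Ux.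
  exists (interior [set y | rho y = 1]); first exact: nbhs_interior.
  exists (mk_test tr); split=> //.
  exists (interior [set y | rho y = 1]); split=> //; first exact: open_interior.
  by move=> y; rewrite inE => /interior_subset.
Qed.

(** Each closed set in the family defining [gf_supp] has the vanishing property, but their
    intersection must be shown to inherit it. A point off [gf_supp l] misses one set of the family,
    so a bump there is invisible to [l]; compactness of the support of [phi] glues these bumps. *)
Lemma gf_supp_out (l : gen_function R) phi :
  fun_supp phi `&` gf_supp l = set0 -> l phi = 0.
Proof.
move=> phil; have [sphi cphi] := testP phi.
(* Asking for a multiplier [theta] that is 1 on [S] and makes [l] vanish on all its multiples turns
   the union step into algebra, through [t1 + t2 - t1 * t2]. *)
pose P (S : set (R3 R)) := exists theta : R3 R -> R, exists2 st : smooth theta,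
  {in S, theta =1 cst 1} & forall psi, l (test_mul psi st) = 0.
suff : P (fun_supp phi).
  move=> [theta [st t1 lt]]; rewrite -(lt phi); congr (l _);
    apply/val_inj/funext => x /=.
  rewrite !fctE; have [/mem_set/t1 ->
    /=|/fun_supp_out ->] := pselect (fun_supp phi x).
    by rewrite mul1r.
  by rewrite mulr0.
apply: (compact_ind cphi).
- exists 0; exists smooth0 => [x|psi]; first by rewrite inE.
  rewrite (_ : test_mul _ _ = 0) ?linear0//; apply/val_inj/funext => x /=.
  by rewrite !fctE mul0r.
- move=> A B [t1 [s1 A1 l1]] [t2 [s2 B1 l2]].
  exists (t1 + t2 - t1 * t2); exists (smoothB (smoothD s1 s2) (smoothM s1 s2)).
    move=> x; rewrite inE !fctE => -[/mem_set/A1|/mem_set/B1] -> /=; ring.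
  move=> psi.
  rewrite (_ : test_mul _ _ = test_mul psi s1 + test_mul psi s2 - test_mul
    (test_mul psi s2) s1).
    by rewrite linearB linearD !l1 l2; ring.
  by apply/val_inj/funext => x /=; rewrite !fctE; ring.
- by move=> A B AB [t [st tB lt]]; exists t; exists st => // x;
  rewrite inE => /AB /mem_set /tB.
- move=> x phix; have : ~ gf_supp l x.
    by move=> lx; have : (fun_supp phi `&` gf_supp l) x by []; rewrite phil.
  rewrite /gf_supp /bigcap /= => /existsNP[S /not_implyP[[cS lS] Sx]].
  have [rho [[srho crho] rhoS r1]] := bump (closed_openC cS) Sx.
  exists [set y | rho y = 1]; first exact: r1.
  exists rho; exists srho => [y|psi]; first by rewrite inE.
  by apply: lS; apply/seteqP; split=> // y [/fun_suppMl/rhoS].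
Qed.

(** Two test functions that agree with [f] near the support of [l] differ by one supported away from
    it, on which [l] vanishes; so the choice inside [cvalue] is harmless. *)
Lemma cvalueE (l : gen_function R) (f : R3 R -> R) (chi : test R) U :
  open U -> gf_supp l `<=` U -> {in U, chi =1 f} -> cvalue l f = l chi.
Proof.
move=> oU lU chif; rewrite /cvalue.
have : is_cvalue l f (xget 0 (is_cvalue l f)).
  by apply: (@xgetI _ _ _ (l chi)); exists chi; split=> //; exists U.
move=> [phi [[V [oV lV phif]] ->]]; apply/eqP; rewrite -subr_eq0 -linearB.
apply/eqP/gf_supp_out/seteqP; split=> // x [+ lx].
suff : fun_supp (phi - chi) `<=` ~` (U `&` V) by move=> /[apply]; apply; split;
  [exact: lU|exact: lV].
apply: fun_suppP; first by apply: open_closedC; exact: openI.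
move=> y + [Uy Vy]; rewrite /= !fctE chif ?inE// phif ?inE//.
by rewrite subrr eqxx.
Qed.

End cutoff.

(** * Integration by parts *)

Lemma bounded_supp_integrable d (T : measurableType d) (R : realType)
    (mu : {measure set T -> \bar R}) (A : set T) (f : T -> R) (M : R) :
  measurable A -> (mu A < +oo)%E -> measurable_fun setT f ->
  (forall x, `|f x| <= M) -> (forall x, f x != 0 -> A x) ->
  mu.-integrable setT (EFin \o f).
Proof.
move=> mA fA mf fM fA0.
have -> : EFin \o f = (EFin \o f) \_ A.
  apply/funext => x; rewrite patchE; case: ifPn => // nAx /=.
  suff -> : f x = 0 by [].
  by apply/eqP; apply: contraNT nAx => fx; rewrite inE; exact: fA0.
have := @integrable_mkcond _ _ _ mu A (EFin \o f) mA; case=> + _; apply;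
  apply: measurable_bounded_integrable => //.
  exact: measurable_funS mf.
by exists M; split; [exact: num_real|move=> y My x _ /=;
  exact: le_trans (fM x) (ltW My)].
Qed.

Section area.
Context {R : realType}.
Notation leb := (@lebesgue_measure R).
(* On leb \x leb, canonical structure inference only reaches the sigma-finite
   instance for products of subprobabilities; hence this alias. *)
Definition area : set (measurableTypeR R * measurableTypeR R) ->
  \bar R := (leb \x leb)%E.
HB.instance Definition _ := Measure.copy area ((leb \x leb)%E :
  {measure set (measurableTypeR R * measurableTypeR R)%type -> \bar R}).
Lemma lebesgue_itv_fin (a b : R) : leb `[a, b]%classic \is a fin_num.
Proof. by rewrite lebesgue_measure_itv/= lte_fin; case: ifP => _;
  rewrite -?EFinD. Qed.
Lemma area_sigma_finite : sigma_finite setT area.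
Proof.
exists (fun n => `[- n%:R, n%:R]%classic `*` `[- n%:R, n%:R]%classic).
  apply/esym/seteqP; split=> // -[x y] _.
  have [n hn] : exists n, Num.max `|x| `|y| < n%:R.
    by exists (Num.bound (Num.max `|x| `|y|)); apply: archi_boundP;
      rewrite le_max normr_ge0.
  exists n => //; move: hn; rewrite gt_max => /andP[/ltW + /ltW].
  by rewrite !ler_norml => hx hy; split; rewrite /= in_itv.
move=> n; split; first by apply: measurableX; exact: measurable_itv.
rewrite /area product_measure1E; [|exact: measurable_itv|exact: measurable_itv].
by rewrite ltey_eq; apply/orP; left; apply: fin_numM; exact: lebesgue_itv_fin.
Qed.
HB.instance Definition _ :=
  Measure_isSigmaFinite.Build _ _ _ area area_sigma_finite.

End area.

Section integration_by_parts.
Context {R : realType}.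
Notation mu := (@volume R).
Notation leb := (@lebesgue_measure R).
Implicit Types (f g : R3 R -> R) (i : 'I_3) (p x : R3 R) (phi psi : test R).

Lemma test_bounded f : continuous f -> compact (fun_supp f) ->
  exists M, forall x, `|f x| <= M.
Proof.
move=> cf csf.
have /compact_bounded[M [_ hM]] : compact (f @` fun_supp f).
  by apply: continuous_compact csf; exact: continuous_subspaceT.
exists (`|M| + 1) => x.
have M1 : M < `|M| + 1 by rewrite ltr_pwDr// ler_norm.
have [fx|/fun_supp_out ->] := pselect (fun_supp f x);
  last by rewrite normr0 addr_ge0.
by apply: (hM _ M1); exists x.
Qed.

Lemma test_integrable f : continuous f -> compact (fun_supp f) ->
  mu.-integrable [set: mR3 R] (EFin \o f).
Proof.
move=> cf csf; have [M fM] := test_bounded cf csf.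
apply: (@bounded_supp_integrable _ _ _ mu (fun_supp f) f M).
- exact: compact_measurable3.
- exact: compact_finite.
- exact: continuous_measurable3.
- exact: fM.
- by move=> x fx; exact: subset_closure.
Qed.

Lemma test_L2 f : continuous f -> compact (fun_supp f) -> L2_on setT f.
Proof.
move=> cf csf; split; first exact: continuous_measurable3.
have cf2 : continuous (f * f) by move=> x; apply: cvgM; exact: cf.
have csf2 : compact (fun_supp (f * f)).
  by apply: subclosed_compact csf _; [exact: closed_closure|exact: fun_suppMl].
have /integrableP[_] := test_integrable cf2 csf2.
apply: le_lt_trans; apply: ge0_le_integral => //.
- by move=> x _; rewrite lee_fin sqr_ge0.
- by apply/measurable_EFinP; apply: measurable_funX; exact: continuous_measurable3.
- by apply/measurable_EFinP; apply: measurableT_comp => //;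
  exact: continuous_measurable3.
- by move=> x _; rewrite /= lee_fin !fctE -expr2 ger0_norm ?sqr_ge0.
Qed.

Definition set_coord i p (t : R) : R3 R :=
  if (i == 0 :> nat)%N then (t, p.1.2, p.2)
  else if (i == 1 :> nat)%N then (p.1.1, t, p.2) else (p.1.1, p.1.2, t).

Lemma coord_set_coord i p t : coord i (set_coord i p t) = t.
Proof. by rewrite /coord /set_coord; case: (_ == 0 :> nat)%N => //;
  case: (_ == 1 :> nat)%N. Qed.

Lemma set_coord_line i p (t h : R) :
  h *: unit_vec i + set_coord i p t = set_coord i p (h + t).
Proof.
case: i => [[|[|[|i]]] hi] //; rewrite /set_coord /unit_vec /=;
  by congr (_, _, _); rewrite /= /GRing.scale/= ?mulr1 ?mulr0 ?add0r.
Qed.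

Lemma continuous_set_coord i p : continuous (set_coord i p).
Proof.
have cpair (V W : topologicalType) (u : R -> V) (v : R -> W) : continuous u ->
  continuous v ->
    continuous (fun t => (u t, v t)).
  by move=> cu cv t; apply: cvg_pair; [exact: cu|exact: cv].
have cc (V : topologicalType) (c : V) : continuous (fun _ : R => c) by move=> t;
  exact: cvg_cst.
have ci : continuous (fun t : R => t) by move=> t; exact: cvg_id.
rewrite /set_coord; case: (_ == 0 :> nat)%N; last case: (_ == 1 :> nat)%N.
- exact: (cpair _ _ _ _ (cpair _ _ _ _ ci (cc _ _)) (cc _ _)).
- exact: (cpair _ _ _ _ (cpair _ _ _ _ (cc _ _) ci) (cc _ _)).
- exact: (cpair _ _ _ _ (cc _ (p.1.1, p.1.2)) ci).
Qed.

Lemma is_derive_set_coord f i p (t : R) : smooth f ->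
  is_derive t 1 (fun s => f (set_coord i p s)) (partial i f (set_coord i p t)).
Proof.
move=> sf; have e : (fun h : R =>
  h^-1 *: ((f \o shift (set_coord i p t)) (h *: unit_vec i) - f (set_coord i p t)))
   = (fun h : R => h^-1 *: (((fun s =>
     f (set_coord i p s)) \o shift t) (h *: (1 : R)) - f (set_coord i p t))).
  by apply/funext => h /=; rewrite set_coord_line /GRing.scale/= mulr1.
split.
  by have := @smooth_derivable _ f i (set_coord i p t) sf; rewrite /derivable e.
by rewrite /partial /derive e.
Qed.

Lemma integral_partial_line f i p : smooth f -> compact (fun_supp f) ->
  (\int[leb]_t (partial i f (set_coord i p t))%:E = 0)%E.
Proof.
move=> sf csf; have [r r0 Kr] := compact_box csf.
have out g : (fun_supp g `<=` fun_supp f) -> forall t, r < `|t| ->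
  g (set_coord i p t) = 0.
  move=> gf t rt; apply: fun_supp_out => /gf.
  move: (coord_set_coord i p t);
    case: (set_coord i p t) => [[x y] z] + /Kr[hx hy hz].
  by rewrite /coord /=; case: ifP => _; [|case: ifP => _] => e; move: rt;
    rewrite -e ltNge ?hx ?hy ?hz.
have cpf : continuous (partial i f) := smooth_continuous (smooth_partial i sf).
have dF t := is_derive_set_coord i p t sf.
(* The vanishing fact [out] needs [r < |t|] strictly; the margin 1 gives it at both endpoints. *)
have ab : - (r + 1) < r + 1 by lra.
transitivity (\int[leb]_(t in `[(- (r + 1))%R,
  (r + 1)%R]) (partial i f (set_coord i p t))%:E)%E.
  rewrite [RHS]integral_mkcond; apply: eq_integral => t _.
  rewrite patchE; case: ifPn => // /negP nt; rewrite (out (partial i f))//.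
    exact: fun_supp_partial.
  rewrite ltNge; apply/negP; rewrite ler_norml => /andP[h1 h2]; apply: nt.
  by rewrite inE/= in_itv/=; apply/andP; split; lra.
have cF : continuous (fun s => f (set_coord i p s)).
  move=> t; apply: (@continuous_comp _ _ _ (set_coord i p) f);
    first exact: continuous_set_coord.
  exact: smooth_continuous.
rewrite (@continuous_FTC2 _ _ (fun s => f (set_coord i p s)) _ _ ab).
- have r1 : r < `|r + 1| by rewrite ger0_norm; lra.
  by rewrite !(out f) ?normrN// subee.
- apply: continuous_subspaceT => t.
  apply: (@continuous_comp _ _ _ (set_coord i p) (partial i f)); last exact: cpf.
  exact: continuous_set_coord.
- split; first by move=> t _; case: (dF t).
  + by apply: cvg_at_right_filter; exact: cF.
  + by apply: cvg_at_left_filter; exact: cF.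
- by move=> t _; rewrite derive1E; case: (dF t).
Qed.

(** Fubini, in the order that puts variable [i] innermost, where the line integral is zero. *)
Lemma integral_partial f i : smooth f -> compact (fun_supp f) ->
  \int[mu]_x partial i f x = 0.
Proof.
move=> sf csf; rewrite /Rintegral.
have cpf : continuous (partial i f) := smooth_continuous (smooth_partial i sf).
have cspf : compact (fun_supp (partial i f)).
  by apply: subclosed_compact csf _;
    [exact: closed_closure|exact: fun_supp_partial].
have ipf := test_integrable cpf cspf.
suff -> : (\int[mu]_x (partial i f x)%:E = 0)%E by [].
have mpf := continuous_measurable3 cpf.
have [M fM] := test_bounded cpf cspf.
have [r r0 Kr] := compact_box csf.
(* Every slice is integrable, not merely almost every one, since it is bounded with bounded support;
   Fubini can then be applied again inside each slice. *)
have islice z : area.-integrable setT (fun q => (partial i f (q, z))%:E).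
  apply: (@bounded_supp_integrable _ (measurableTypeR R * measurableTypeR R)%type
    R area (`[- r, r]%classic `*` `[- r, r]%classic) (fun q =>
    partial i f (q, z)) M).
  - by apply: measurableX; exact: measurable_itv.
  - rewrite /= /area product_measure1E;
    [|exact: measurable_itv|exact: measurable_itv].
    by rewrite ltey_eq; apply/orP; left; apply: fin_numM; exact: lebesgue_itv_fin.
  - exact: measurable_fun_pair1 mpf.
  - by move=> p; exact: fM.
  - move=> [x y] /= pxyz.
    have /Kr[] : fun_supp f (x, y, z) by apply: (@fun_supp_partial _ i);
      exact: subset_closure.
    by rewrite !ler_norml => hx hy _; split; rewrite /= in_itv.
have line p := integral_partial_line i p sf csf.
move: line; rewrite /set_coord.
have F12 := @integral12_prod_meas1 _ _ _ _ R area leb _ ipf.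
have F21 := @integral21_prod_meas1 _ _ _ _ R area leb _ ipf.
have S12 z := @integral12_prod_meas1 _ _ _ _ R leb leb _ (islice z).
have S21 z := @integral21_prod_meas1 _ _ _ _ R leb leb _ (islice z).
have [i0|i0] := boolP (i == 0 :> nat)%N.
  move=> line; apply: (eq_trans (esym F21)); apply: integral0_eq => z _.
  apply: (eq_trans (esym (S21 z))); apply: integral0_eq => y _.
  exact: (line (0, y, z)).
have [i1|i1] := boolP (i == 1 :> nat)%N.
  move=> line; apply: (eq_trans (esym F21)); apply: integral0_eq => z _.
  apply: (eq_trans (esym (S12 z))); apply: integral0_eq => x _.
  exact: (line (x, 0, z)).
move=> line; apply: (eq_trans (esym F12)); apply: integral0_eq => -[x y] _.
exact: (line (x, y, 0)).
Qed.

(** The product [phi * psi] is a test function, so its partial has integral zero; the product rule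
    splits that integral. *)
Lemma test_generalized_partial i phi : generalized_partial i phi (partial i phi).
Proof.
move=> psi.
have [sphi cphi] := testP phi; have [spsi cpsi] := testP psi.
pose f : R3 R -> R := phi; pose g : R3 R -> R := psi.
have := @integral_partial (f * g) i (smoothM sphi spsi) (is_testM psi sphi).2.
have e : partial i (f * g) = f * partial i g + partial i f * g.
  apply/funext => x; rewrite /partial deriveM//; try exact: smooth_derivable.
  by rewrite !fctE /GRing.scale/= [X in _ + X]mulrC.
have cdphi : compact (fun_supp (partial i f)).
  by apply: subclosed_compact cphi _;
    [exact: closed_closure|exact: fun_supp_partial].
have I u v : smooth u -> smooth v -> compact (fun_supp u) ->
    mu.-integrable [set: mR3 R] (EFin \o (u * v)).
  move=> sf sg cf; apply: test_integrable; first exact/smooth_continuous/smoothM.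
  by apply: subclosed_compact cf _; [exact: closed_closure|exact: fun_suppMl].
rewrite e (RintegralD measurableT (I _ _ sphi (smooth_partial i spsi) cphi)
  (I _ _ (smooth_partial i sphi) spsi cdphi)).
by move=> /eqP; rewrite addr_eq0 => /eqP.
Qed.

End integration_by_parts.

(** * The Dirichlet class *)

Section dirichlet.
Context {R : realType}.
Notation mu := (@volume R).
Notation V := (R3 R -> R).
Implicit Types (f g h : V) (i : 'I_3) (phi psi : test R) (F G : 'I_3 ->
  V) (K : set (R3 R)).

Lemma L2_onS (A B : set (mR3 R)) f : measurable A -> measurable B -> A `<=` B ->
  L2_on B f -> L2_on A f.
Proof.
move=> mA mB AB [mf f2]; split; first exact: measurable_funS mf.
apply: le_lt_trans f2; apply: ge0_subset_integral => //.
- by apply/measurable_EFinP; exact: measurable_funX.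
- by move=> x _; rewrite lee_fin sqr_ge0.
Qed.

Lemma compact_testP phi i : compact (fun_supp (partial i phi)).
Proof.
have [_ cphi] := testP phi.
by apply: subclosed_compact cphi _; [exact: closed_closure|exact: fun_supp_partial].
Qed.

Definition test_partial i phi : test R :=
  mk_test (conj (smooth_partial i (testP phi).1) (@compact_testP phi i)).

Lemma test_valL2 phi : L2_on setT phi.
Proof. by have [sphi cphi] := testP phi; apply: test_L2 => //;
  exact: smooth_continuous. Qed.

Lemma test_measurable phi : measurable_fun [set: mR3 R] phi.
Proof. by case: (test_valL2 phi). Qed.

Lemma L2_cvg_lin (A : set (mR3 R)) a (f_ g_ : nat -> V) f g : measurable A ->
  (forall n, measurable_fun A (f_ n - f)) ->
    (forall n, measurable_fun A (g_ n - g)) ->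
  L2_cvg_on A f_ f -> L2_cvg_on A g_ g ->
  L2_cvg_on A (fun n => a *: f_ n + g_ n) (a *: f + g).
Proof.
move=> mA mf mg cf cg; rewrite /L2_cvg_on.
have c0 : ((2 * a ^+ 2)%:E * \int[mu]_(x in A) ((f_ n x - f x) ^+ 2)%:E +
   2%:E * \int[mu]_(x in A) ((g_ n x - g x) ^+ 2)%:E)%E @[n --> \oo] --> 0%E.
  have h1 := cvgeZl (y := (2 * a ^+ 2)%:E) isT cf;
    have h2 := cvgeZl (y := 2%:E) isT cg.
  by move: h1 h2; rewrite !mule0 => h1 h2; have := cvgeD _ h1 h2; rewrite adde0;
    apply.
apply: squeeze_cvge (cvg_cst _) c0; apply: nearW => n; apply/andP; split.
  by apply: integral_ge0 => x _; rewrite lee_fin sqr_ge0.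
apply: le_trans (integral_sqr_lin mu mA a (mf n) (mg n)).
rewrite le_eqVlt; apply/orP; left; apply/eqP; apply: eq_integral => x _;
  congr (_ ^+ 2)%:E.
by rewrite !fctE /GRing.scale/=; ring.
Qed.

Lemma L2_cvg_L2 (A : set (mR3 R)) (f_ : nat -> V) f : measurable A ->
  measurable_fun A f -> (forall n, L2_on A (f_ n)) -> L2_cvg_on A f_ f -> L2_on A f.
Proof.
move=> mA mf Lf cf.
have /fine_cvgP[ffin fcvg] := cf.
have [N _ /(_ N (leqnn N))[fn h1]] := filterI ffin (cvgr_lt _ fcvg _ ltr01).
have h : (\int[mu]_(x in A) ((f_ N x - f x) ^+ 2)%:E < 1)%E by rewrite -(fineK
  fn) lte_fin.
have Ld : L2_on A (f_ N - f).
  split; first by apply: measurable_funB => //; case: (Lf N).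
  by apply: lt_trans h _; rewrite ltry.
have -> : f = f_ N - (f_ N - f) by rewrite opprB addrCA subrr addr0.
exact: (si_B (semi_inner_ip mu mA) (Lf N) Ld).
Qed.

Lemma dirichlet_L2 f K : dirichlet f -> compact K -> L2_on K f.
Proof.
move=> [mf [G [_ [phi_ [cphi _]]]]] cK; have mK := compact_measurable3 cK.
apply: (L2_cvg_L2 mK _ _ (cphi K cK)); first exact: measurable_funS mf.
by move=> n; apply: L2_onS (test_valL2 _).
Qed.

(** A Dirichlet function need not be square integrable on the whole space, only on compact sets.
    Passing to a set that carries [g] makes the bilinearity of [ip] available. *)
Lemma ip_supp (A : set (mR3 R)) f g : (forall x, g x != 0 -> A x) ->
  ip mu setT f g = ip mu A f g.
Proof.
move=> gA; rewrite /ip [RHS]Rintegral_mkcond; apply: eq_Rintegral => x _.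
rewrite patchE; case: ifPn => // /negP nx; suff -> : g x = 0 by rewrite mulr0.
by apply/eqP; apply: contrapT => /negP /gA Ax; apply: nx; rewrite inE.
Qed.

Lemma is_dgrad_lin a f g F G : measurable_fun [set: mR3 R] f ->
  measurable_fun [set: mR3 R] g ->
  is_dgrad f F -> is_dgrad g G -> is_dgrad (a *: f + g) (fun i => a *: F i + G i).
Proof.
move=> mf mg df dg.
have Df : dirichlet f by split=> //; exists F.
have Dg : dirichlet g by split=> //; exists G.
move: df dg => [df [phi_ [cphi cdphi]]] [dg [psi_ [cpsi cdpsi]]].
split.
  move=> i; have [LF gF] := df i; have [LG gG] := dg i; split.
    by have := si_lin (semi_inner_ip mu measurableT) a LF LG.
  move=> psi; have [spsi cpsi'] := testP psi.
  have sub x : partial i psi x != 0 -> fun_supp psi x.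
    by move=> h; apply: (@fun_supp_partial _ i); exact: subset_closure.
  have mK := compact_measurable3 cpsi'.
  rewrite -/(ip mu setT (a *: f + g) (partial i psi)) (ip_supp _ sub).
  rewrite (si_linl (semi_inner_ip mu mK)); last 3 first.
  - exact: dirichlet_L2.
  - exact: dirichlet_L2.
  - exact: L2_onS (test_valL2 (test_partial i psi)).
  rewrite -!(ip_supp _ sub).
  rewrite -/(ip mu setT (a *: F i + G i) psi) (si_linl (semi_inner_ip mu
    measurableT)) //; last exact: test_valL2.
  by rewrite /ip gF gG; ring.
exists (fun n => a *: phi_ n + psi_ n); split.
  move=> K cK; have mK := compact_measurable3 cK; apply: L2_cvg_lin => //.
  - by move=> n; apply: measurable_funB;
    [exact: measurable_funS (test_measurable _)|exact: measurable_funS mf].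
  - by move=> n; apply: measurable_funB;
    [exact: measurable_funS (test_measurable _)|exact: measurable_funS mg].
  - exact: cphi.
  - exact: cpsi.
move=> i; have [[mF _] _] := df i; have [[mG _] _] := dg i.
rewrite (_ : (fun n => _) = (fun n =>
  a *: partial i (phi_ n) + partial i (psi_ n))).
  apply: L2_cvg_lin => //.
  - by move=> n; apply: measurable_funB => //;
    exact: (test_measurable (test_partial i (phi_ n))).
  - by move=> n; apply: measurable_funB => //;
    exact: (test_measurable (test_partial i (psi_ n))).
apply/funext => n; have [s1 _] := testP (phi_ n); have [s2 _] := testP (psi_ n).
exact: (partials_lin a [:: i] s1 s2).
Qed.

Lemma is_dgrad_test phi : is_dgrad phi (fun i => partial i phi).
Proof.
split; first by move=> i; split;
  [exact: (test_valL2 (test_partial i phi))|exact: test_generalized_partial].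
have c0 (A : set (mR3 R)) f : L2_cvg_on A (fun=> f) f.
  rewrite /L2_cvg_on (_ : (fun n => _) = cst 0%E); first exact: cvg_cst.
  by apply/funext => n; apply: integral0_eq => x _; rewrite subrr expr0n.
by exists (fun=> phi); split=> [K cK|i]; exact: c0.
Qed.

Lemma dirichlet_test phi : dirichlet phi.
Proof. by split; [exact: test_measurable|exists (fun i => partial i phi);
  exact: is_dgrad_test]. Qed.

Lemma dirichlet_lin a f g : dirichlet f -> dirichlet g -> dirichlet (a *: f + g).
Proof.
move=> [mf [F dF]] [mg [G dG]]; split.
  by apply: measurable_funD => //; exact: measurable_funM.
by exists (fun i => a *: F i + G i); exact: is_dgrad_lin.
Qed.

Lemma dgradP f : dirichlet f -> is_dgrad f (dgrad f).
Proof. by move=> [_ [G dG]]; exact: (xgetI _ dG). Qed.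

Notation ipT := (ip mu setT).
Notation siT := (semi_inner_ip mu measurableT).

(* No appeal to the fundamental lemma of the calculus of variations: G i is an
   L2 limit of the test functions partial i (theta_ n), and it is orthogonal to
   every test function. *)
Lemma is_dgrad0 G i : is_dgrad (0 : V) G -> ipT (G i) (G i) = 0.
Proof.
move=> [dG [theta_ [_ /(_ i) cG]]]; have [LG gG] := dG i.
have orth psi : ipT (G i) psi = 0.
  have := gG psi; rewrite /ip => /eqP; rewrite eq_sym eqr_oppLR => /eqP ->.
  rewrite (_ : Rintegral _ _ _ = 0) ?oppr0// /Rintegral.
  by rewrite integral0_eq// => x _; rewrite mul0r.
have Lt n : L2_on setT (partial i (theta_ n)) :=
  test_valL2 (test_partial i (theta_ n)).
(* Pythagoras: by orthogonality the squared distance is the sum of the two squared norms, hence at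
   least that of [G i], while it tends to 0. *)
have ge n : ((ipT (G i) (G i))%:E <= \int[mu]_x ((partial i (theta_ n) x - G i x)
  ^+ 2)%:E)%E.
  rewrite -(@ip_self _ _ _ mu setT measurableT (partial i (theta_ n) - G i));
    last by exact: (si_B siT (Lt n) LG).
  have e := etrans (si_sym siT (partial i (theta_ n)) (G i))
    (orth (test_partial i (theta_ n))).
  have := si_quadB siT (Lt n) LG; rewrite e mulr0 subr0 lee_fin => ->.
  by rewrite lerDr; exact: (si_ge0 siT (Lt n)).
apply/eqP; rewrite eq_le (si_ge0 siT LG) andbT -lee_fin.
by apply: (cvge_ge _ cG); exact: nearW.
Qed.

End dirichlet.

Lemma Rintegral_sum d (T : measurableType d) (R : realType)
    (mu : {measure set T -> \bar R}) (A : set T) (I : Type) (r : seq I) (f : I -> T -> R) : measurable A ->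
  (forall i, mu.-integrable A (EFin \o f i)) ->
  mu.-integrable A (EFin \o (fun x => \sum_(i <- r) f i x)) /\
  \int[mu]_(x in A) (\sum_(i <- r) f i x) = \sum_(i <- r) \int[mu]_(x in A) f i x.
Proof.
move=> mA intf; elim: r => [|i r [IH1 IH2]].
  have e : (fun x => \sum_(i <- [::]) f i x) = cst 0 by apply/funext => x;
    rewrite big_nil.
  split; first by rewrite e; exact: integrable0.
  by rewrite e big_nil /Rintegral integral0_eq.
have e : (fun x => \sum_(j <- i :: r) f j x) = (fun x =>
  f i x + \sum_(j <- r) f j x).
  by apply/funext => x; rewrite big_cons.
rewrite e big_cons -IH2; split; last by rewrite RintegralD.
exact: (integrableD mA (intf i) IH1).
Qed.

Lemma cvg_sum0 (R : realType) (I : Type) (r : seq I) (e : I -> nat -> R) :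
  (forall i, e i n @[n --> \oo] --> 0) -> \sum_(i <- r) e i n @[n --> \oo] --> 0.
Proof.
move=> ce; elim: r => [|i r IH].
  rewrite (_ : (fun n => _) = cst 0); first exact: cvg_cst.
  by apply/funext => n; rewrite big_nil.
rewrite (_ : (fun n => _) = (fun n => e i n + \sum_(j <- r) e j n)).
  by rewrite -[X in _ --> X]addr0; exact: cvgD.
by apply/funext => n; rewrite big_cons.
Qed.

(** * The Dirichlet form and the k-form *)

Section dirichlet_form.
Context {R : realType}.
Notation mu := (@volume R).
Notation V := (R3 R -> R).
Implicit Types (f g h : V) (i : 'I_3) (phi psi : test R) (F G : 'I_3 ->
  V) (K : set (R3 R)).
Notation ipT := (ip mu setT).
Notation siT := (semi_inner_ip mu measurableT).

Lemma dirichlet_measurable f : dirichlet f -> measurable_fun [set: mR3 R] f.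
Proof. by case. Qed.

Lemma is_dgrad_L2 f G i : is_dgrad f G -> L2 mu setT (G i).
Proof. by case=> /(_ i)[]. Qed.

(** The difference of two gradients of [f] is a gradient of 0, hence of zero norm, and
    Cauchy-Schwarz kills its pairing with [h]. *)
Lemma is_dgrad_uniq f F G h i : measurable_fun [set: mR3 R] f ->
  is_dgrad f F -> is_dgrad f G -> L2 mu setT h -> ipT (F i) h = ipT (G i) h.
Proof.
move=> mf dF dG Lh.
have LF := is_dgrad_L2 i dF; have LG := is_dgrad_L2 i dG.
have := is_dgrad_lin (-1) mf mf dG dF.
rewrite scaleN1r addNr => d; have := @is_dgrad0 _ _ i d;
  rewrite scaleN1r addrC => e.
have := si_CS siT (si_B siT LF LG) Lh; rewrite e mul0r => h0.
apply/eqP; rewrite -subr_eq0 -(si_linBl siT LF LG Lh) -sqrf_eq0 eq_le h0/=.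
exact: sqr_ge0.
Qed.

Definition dform f g : R := \int[mu]_x (\sum_i dgrad f i x * dgrad g i x).

(** The choice [dgrad] is not linear in [f]. Allowing any gradients in its place lets bilinearity
    follow from [is_dgrad_lin]. *)
Lemma dformE f g F G : dirichlet f -> dirichlet g -> is_dgrad f F -> is_dgrad g G ->
  dform f g = \sum_i ipT (F i) (G i).
Proof.
move=> Df Dg dF dG.
have I i := L2_integrable measurableT (is_dgrad_L2 i (dgradP Df)) (is_dgrad_L2 i
  (dgradP Dg)).
transitivity (\sum_i ipT (dgrad f i) (dgrad g i)).
  by rewrite /dform (Rintegral_sum _ measurableT I).2.
apply: eq_bigr => i _.
have LG' := is_dgrad_L2 i (dgradP Dg).
rewrite (is_dgrad_uniq _ (dirichlet_measurable Df) (dgradP Df) dF LG').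
rewrite (si_sym siT) (is_dgrad_uniq _ (dirichlet_measurable Dg) (dgradP Dg) dG
  (is_dgrad_L2 i dF)).
exact: (si_sym siT).
Qed.

Lemma semi_inner_dform : semi_inner (@dirichlet R) dform.
Proof.
split; first exact: dirichlet_lin.
- by move=> f g; apply: eq_Rintegral => x _; apply: eq_bigr => i _; rewrite mulrC.
- move=> a f g h Df Dg Dh.
  have d := is_dgrad_lin a (dirichlet_measurable Df) (dirichlet_measurable Dg)
    (dgradP Df) (dgradP Dg).
  rewrite (dformE (dirichlet_lin a Df Dg) Dh d (dgradP Dh)).
  rewrite (dformE Df Dh (dgradP Df) (dgradP Dh)) (dformE Dg Dh (dgradP Dg)
    (dgradP Dh)).
  rewrite mulr_sumr -big_split/=; apply: eq_bigr => i _.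
  by rewrite (si_linl siT)//; exact: is_dgrad_L2 (dgradP _).
- move=> f Df; rewrite (dformE Df Df (dgradP Df) (dgradP Df)).
  by apply: sumr_ge0 => i _; apply: (si_ge0 siT); exact: is_dgrad_L2 (dgradP _).
Qed.

Lemma denergyE f : dirichlet f -> denergy f = (dform f f)%:E.
Proof.
move=> Df; rewrite /dform /Rintegral fineK /denergy.
  by apply: eq_integral => x _; congr EFin; apply: eq_bigr => i _; rewrite expr2.
have I i := L2_integrable measurableT (is_dgrad_L2 i (dgradP Df)) (is_dgrad_L2 i
  (dgradP Df)).
by apply: integrable_fin_num => //; exact: (Rintegral_sum _ measurableT I).1.
Qed.

Lemma dnormE f : dirichlet f -> dnorm f = Num.sqrt (dform f f).
Proof. by move=> Df; rewrite /dnorm denergyE. Qed.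

Lemma dnorm_sqr f : dirichlet f -> dnorm f ^+ 2 = dform f f.
Proof. by move=> Df; rewrite dnormE// sqr_sqrtr// (si_ge0 semi_inner_dform). Qed.

Lemma dirichletB f g : dirichlet f -> dirichlet g -> dirichlet (f - g).
Proof. exact: (si_B semi_inner_dform). Qed.

Lemma dnorm_cvg0 (f_ : nat -> V) : (forall n, dirichlet (f_ n)) ->
  dform (f_ n) (f_ n) @[n --> \oo] --> 0 -> dnorm (f_ n) @[n --> \oo] --> 0.
Proof.
move=> Df c; rewrite (_ : (fun n => _) = (fun n => Num.sqrt (dform (f_ n) (f_ n)))).
  rewrite -[X in _ --> X]sqrtr0; apply: continuous_cvg c; exact: sqrt_continuous.
by apply/funext => n; rewrite dnormE.
Qed.

(** Without an approximating sequence [is_dvalue l f] would hold of every number; this is what makes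
    the extension of [l] unique. *)
Lemma dirichlet_approx f : dirichlet f -> exists phi_ : nat -> test R,
  dnorm (fun x => phi_ n x - f x) @[n --> \oo] --> 0.
Proof.
move=> Df; have [_ [G dG]] := Df; have [_ [phi_ [_ cphi]]] := dG; exists phi_.
have D n := dirichletB (dirichlet_test (phi_ n)) Df.
apply: (dnorm_cvg0 D).
have LG i := is_dgrad_L2 i dG.
have Lp n i := is_dgrad_L2 i (is_dgrad_test (phi_ n)).
pose e i n := ipT (partial i (phi_ n) - G i) (partial i (phi_ n) - G i).
rewrite (_ : (fun n => _) = (fun n => \sum_i e i n)).
  apply: cvg_sum0 => i.
  have /fine_cvgP[_] := cphi i; apply: cvg_trans; apply: near_eq_cvg;
    apply: nearW => n /=.
  by rewrite /e -[LHS]/(fine (_)%:E) (ip_self _ (si_B siT (Lp n i) (LG i))).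
apply/funext => n.
have := is_dgrad_lin (-1) (dirichlet_measurable Df) (dirichlet_measurable
  (dirichlet_test (phi_ n)))
  dG (is_dgrad_test (phi_ n)).
rewrite scaleN1r addrC => d.
rewrite (dformE (D n) (D n) d d); apply: eq_bigr => i _.
by rewrite scaleN1r addrC.
Qed.

(** Through this, a functional bounded in the Dirichlet norm is continuous on test functions, hence
    a generalized function. *)
Lemma test_cvg_dnorm (phi_ : nat -> test R) phi : test_cvg phi_ phi ->
  dnorm (fun x => phi_ n x - phi x) @[n --> \oo] --> 0.
Proof.
move=> [[K cK phiK] cphi].
have D n := dirichlet_test (phi_ n - phi).
apply: (@dnorm_cvg0 (fun n => phi_ n - phi) D).
(* [test_cvg] confines only the supports of the [phi_ n]; the limit inherits [K] by pointwise
   convergence. *)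
have K' : fun_supp phi `<=` K.
  apply: fun_suppP; first by apply: compact_closed.
  move=> x phix; apply: contrapT => nKx.
  have p0 : 0 < `|phi x| / 2 by rewrite divr_gt0// normr_gt0.
  have [N _ /(_ N (leqnn N)) /(_ x)/=] := cphi [::] _ p0.
  rewrite (_ : phi_ N x = 0) ?sub0r ?normrN; last by apply: fun_supp_out => /phiK.
  lra.
have mK := compact_measurable3 cK.
have fK := compact_finite cK.
pose v := fine (mu (K : set (mR3 R))).
have v0 : 0 <= v by rewrite /v fine_ge0.
apply/cvgrPdist_le => /= e e0.
(* Each of the three partials contributes at most [m ^+ 2 * v] with [m] this minimum: [m <= 1] gives
   [m ^+ 2 <= m], and the second bound gives [m * v <= e / 3]. The [+ 1] covers a null [K]. *)
have d0 : 0 < Num.min 1 (e / (3 * (v + 1))).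
  by rewrite lt_min ltr01/= divr_gt0// mulr_gt0//; lra.
have c i : \forall n \near \oo, forall x,
    `|partial i (phi_ n) x - partial i phi x| <= Num.min 1 (e / (3 * (v + 1))).
  exact: (cphi [:: i] _ d0).
have cc : \forall n \near \oo, forall i, forall x,
   `|partial i (phi_ n) x - partial i phi x| <= Num.min 1 (e / (3 * (v + 1))).
  have [N _ hN] := filterI (c ord0) (filterI (c (lift ord0 ord0)) (c ord_max)).
  exists N => // n /hN[h0 [h1 h2]].
  move=> i; have : [\/ i = ord0, i = lift ord0 ord0 | i = ord_max].
    by case: i => [[|[|[|//]]] hi]; [constructor 1|constructor 2|constructor 3];
      exact: val_inj.
  by case=> -> x; [exact: h0|exact: h1|exact: h2].
move: cc; apply: filterS => n hn.
rewrite sub0r normrN (dformE (D n) (D n) (is_dgrad_test _) (is_dgrad_test _)).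
rewrite ger0_norm; last first.
  by apply: sumr_ge0 => i _; apply: Rintegral_ge0 => x _; exact: sqr_ge0.
apply: (@le_trans _ _ (\sum_(i < 3) (e / 3))); last first.
  by rewrite sumr_const card_ord -mulr_natr; lra.
apply: ler_sum => i _.
have [s1 _] := testP (phi_ n); have [s2 _] := testP phi.
have pe : partial i (phi_ n - phi) = partial i (phi_ n) - partial i phi.
  have := partials_lin (-1) [:: i] s2 s1;
    rewrite !scaleN1r [X in partials _ X]addrC [RHS]addrC.
  exact.
have supp x : partial i (phi_ n - phi) x != 0 -> K x.
  apply: contraNP => nK; rewrite pe !fctE !fun_supp_out ?subrr//.
    by move=> /fun_supp_partial/K'.
  by move=> /fun_supp_partial/phiK.
rewrite (ip_supp _ supp).
set m := Num.min _ _ in hn d0.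
apply: (@le_trans _ _ (\int[mu]_(x in K) (cst (m ^+ 2) x))).
  apply: le_Rintegral => //.
  - have L := L2_onS mK measurableT (@subsetT _ _)
      (test_valL2 (test_partial i (phi_ n - phi))).
    exact: (L2_integrable mK L L).
  - apply: measurable_bounded_integrable => //.
    by exists (m ^+ 2); split=> [|y my x _ /=];
      rewrite ?num_real// ger0_norm ?sqr_ge0// ltW.
  - move=> x _; rewrite -expr2 -real_normK ?num_real//.
    by apply: lerXn2r; rewrite ?nnegrE ?(ltW d0)// pe; exact: hn.
rewrite Rintegral_cst// -/v.
have m1 : m <= 1 by rewrite ge_min lexx.
have m2 : m * (3 * (v + 1)) <= e by rewrite -ler_pdivlMr ?ge_min ?lexx ?orbT//; lra.
have mm : m ^+ 2 <= m by rewrite expr2 ler_piMr// ltW.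
have : m ^+ 2 * v <= m * v by rewrite ler_wpM2r.
lra.
Qed.

Variables (E : set (R3 R)) (k : R).
Hypothesis cE : compact E.

Lemma kformE f g : kform E k f g = (4 * pi)^-1 * dform f g - k ^+ 2 * ip mu E f g.
Proof. by []. Qed.

Lemma kform_le f : dirichlet f -> kform E k f f <= (4 * pi)^-1 * dnorm f ^+ 2.
Proof.
move=> Df; rewrite kformE dnorm_sqr// gerBl mulr_ge0 ?sqr_ge0//.
exact: (si_ge0 (semi_inner_ip mu (compact_measurable3 cE)) (dirichlet_L2 Df cE)).
Qed.

Hypothesis (k0 : 0 < k) (kE : (k%:E <= poincare_const E)%E).

(** The inequality is given for members of the set whose supremum is [poincare_const E], not at [k]
    itself. If it failed at [f], the critical value [sqrt (b / a)] would lie below [k], so some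
    member of the set would exceed it and contradict its own inequality. *)
Lemma kform_ge0 f : dirichlet f -> 0 <= kform E k f f.
Proof.
move=> Df; have mE := compact_measurable3 cE; have LE := dirichlet_L2 Df cE.
rewrite kformE subr_ge0 leNgt; apply/negP => h.
set b := (4 * pi)^-1 * _ in h; set a := ip _ _ _ _ in h.
have a0 : 0 <= a by exact: (si_ge0 (semi_inner_ip mu mE) LE).
have b0 : 0 <= b.
  by rewrite mulr_ge0 ?(si_ge0 semi_inner_dform)// invr_ge0 mulr_ge0// pi_ge0.
have a1 : 0 < a.
  by rewrite lt_neqAle a0 andbT; apply: contraTN h => /eqP <-; rewrite mulr0 -leNgt.
have ba : 0 <= b / a by rewrite divr_ge0.
have lt : ((Num.sqrt (b / a))%:E < poincare_const E)%E.
  apply: lt_le_trans kE;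
    rewrite lte_fin -[ltRHS]ger0_norm ?ltW// -sqrtr_sqr ltr_sqrt ?exprn_gt0//.
  by rewrite ltr_pdivrMr.
have [_ [k' [k'0 hk'] <-]] := ereal_sup_gt lt.
rewrite lte_fin => kk'; have := hk' f Df.
rewrite denergyE// -(ip_self mE LE) -!EFinM lee_fin -/a -/b.
apply/negP; rewrite -ltNge -ltr_pdivrMr//.
by rewrite -(sqr_sqrtr ba) ltrXn2r// ?nnegrE ?sqrtr_ge0.
Qed.

Lemma semi_inner_kform : semi_inner (@dirichlet R) (kform E k).
Proof.
have siE := semi_inner_ip mu (compact_measurable3 cE).
split; first exact: dirichlet_lin.
- by move=> f g; rewrite !kformE (si_sym semi_inner_dform) (si_sym siE).
- move=> a f g h Df Dg Dh;
  rewrite !kformE (si_linl semi_inner_dform)// (si_linl siE).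
  + by move: (dform f h) (dform g h) (ip _ _ _ _) (ip _ _ _ _) => *; ring.
  + exact: dirichlet_L2.
  + exact: dirichlet_L2.
  + exact: dirichlet_L2.
- exact: kform_ge0.
Qed.

End dirichlet_form.

(** * The variational problem *)

Section dual.
Context {R : realType}.
Notation V := (R3 R -> R).
Implicit Types (f g : V) (phi psi : test R) (l : gen_function R).

Lemma test_dnorm_subrr phi : dnorm (fun x => phi x - phi x) = 0.
Proof.
have -> : (fun x => phi x - phi x) = (phi : V) - phi by [].
have Dp := dirichlet_test phi; rewrite dnormE; last exact: dirichletB.
by rewrite (si_quadB semi_inner_dform)// (_ : _ - _ + _ = 0) ?sqrtr0//; ring.
Qed.

Lemma is_dvalue_test l phi y : is_dvalue l phi y -> y = l phi.
Proof.
move=> /(_ (fun=> phi)) h; have {h} : l phi @[n --> \oo] --> y.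
  by apply: h; rewrite test_dnorm_subrr; exact: cvg_cst.
by move=> h; exact: (norm_cvg_unique h (cvg_cst _)).
Qed.

Lemma is_dvalue_uniq l f y z : dirichlet f -> is_dvalue l f y ->
  is_dvalue l f z -> y = z.
Proof.
move=> Df hy hz; have [phi_ cphi] := dirichlet_approx Df.
exact: (norm_cvg_unique (hy _ cphi) (hz _ cphi)).
Qed.

Lemma dvalue_test l phi : dual_dirichlet l -> dvalue l phi = l phi.
Proof. by move=> [M /(_ _ (dirichlet_test phi))[+ _]]; exact: is_dvalue_test. Qed.

(** The midpoint and the limit of the minimizing sequence are first found as linear forms on the
    Dirichlet class; this turns them into distributions and recovers the form as their extension. *)
Lemma bounded_form_dual (L : V -> R) (C : R) : 0 <= C ->
  (forall a f g, dirichlet f -> dirichlet g -> L (a *: f + g) = a * L f + L g) ->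
  (forall f, dirichlet f -> L f ^+ 2 <= C * dnorm f ^+ 2) ->
  exists l, [/\ forall phi, l phi = L phi, dual_dirichlet l &
    forall f, dirichlet f -> dvalue l f = L f].
Proof.
move=> C0 linL bL.
have LB f g : dirichlet f -> dirichlet g -> L (f - g) = L f - L g.
  by move=> Df Dg; rewrite addrC -scaleN1r linL//; ring.
have bL' f : dirichlet f -> `|L f| <= Num.sqrt C * dnorm f.
  move=> Df; rewrite -sqrtr_sqr -[leRHS]ger0_norm; last first.
    by rewrite mulr_ge0 ?sqrtr_ge0// dnormE// sqrtr_ge0.
  by rewrite -sqrtr_sqr; apply: ler_wsqrtr; rewrite exprMn sqr_sqrtr//; exact: bL.
have cvgL f (phi_ : nat -> test R) : dirichlet f ->
    dnorm (fun x => phi_ n x - f x) @[n --> \oo] --> 0 ->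
      L (phi_ n) @[n --> \oo] --> L f.
  move=> Df c; apply/subr_cvg0.
  have c0 : Num.sqrt C * dnorm (fun x => phi_ n x - f x) @[n --> \oo] --> 0.
    by rewrite -[X in _ --> X](mulr0 (Num.sqrt C)); apply: cvgMr; exact: c.
  have c1 : - (Num.sqrt C * dnorm (fun x => phi_ n x - f x)) @[n --> \oo] --> 0.
    by rewrite -[X in _ --> X]oppr0; exact: cvgN.
  apply: squeeze_cvgr c1 c0; apply: nearW => n; rewrite -ler_norml.
  have Dp := dirichlet_test (phi_ n).
  by rewrite -(LB _ _ Dp Df); apply: bL'; exact: dirichletB.
pose T : test R -> R := fun phi => L phi.
have linT : GRing.linear_for *%R T.
  by move=> a phi psi; apply: linL; exact: dirichlet_test.
pose mix := GRing.isLinear.Build R (test R) R *%R T linT.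
pose TL : {scalar test R} := HB.pack T mix.
have cT (phi_ : nat -> test R) phi : test_cvg phi_ phi ->
  TL (phi_ n) @[n --> \oo] --> TL phi.
  by move=> /test_cvg_dnorm; apply: cvgL; exact: dirichlet_test.
pose l := GenFunction cT.
have dvL f : dirichlet f -> is_dvalue l f (L f).
  by move=> Df phi_; exact: cvgL.
have dvE f : dirichlet f -> dvalue l f = L f.
  by move=> Df; apply: (is_dvalue_uniq Df) (dvL _ Df); exact: (xgetI _ (dvL _ Df)).
exists l; split=> //.
by exists (Num.sqrt C) => f Df; rewrite dvE//; split; [exact: dvL|exact: bL'].
Qed.


(** * Minimization of the k-energy over [Ch E q] *)

Section capacity.
Variables (E : set (R3 R)) (q k : R).
Hypotheses (cE : compact E) (k0 : 0 < k) (kE : (k%:E <= poincare_const E)%E).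
Hypothesis potE : kpotential_exists_unique E k.

Notation B := (kform E k).
Notation U := (kpotential E k).
Let siB := semi_inner_kform cE k0 kE.

Lemma kpotentialP l : dual_dirichlet l -> is_kpotential E k l (U l).
Proof. by move=> /potE[[W hW] _]; exact: (xgetI _ hW). Qed.

Lemma kform_test l phi : dual_dirichlet l -> l phi = B phi (U l).
Proof.
move=> dl; rewrite -(dvalue_test _ dl).
by have [_] := kpotentialP dl; apply; exact: dirichlet_test.
Qed.

(** The potential is a chosen representative, yet [B U U = l(U) = B U W = l(W) = B W W] for any
    other potential [W]. *)
Lemma kenergyE l W : dual_dirichlet l -> is_kpotential E k l W ->
  kenergy E k l = B W W.
Proof.
move=> dl [DW hW]; have [DU hU] := kpotentialP dl.
by rewrite /kenergy (hU _ DU) -(hU _ DU) (hW _ DU) (si_sym siB) -(hU _ DW) (hW _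
  DW).
Qed.

(** Makes [B^~ W] eligible for [bounded_form_dual]: every Dirichlet function is the potential of
    some distribution. *)
Lemma kform_bound W f : dirichlet W -> dirichlet f ->
  B f W ^+ 2 <= (4 * pi)^-1 * B W W * dnorm f ^+ 2.
Proof.
move=> DW Df; apply: (le_trans (si_CS siB Df DW)); rewrite [leRHS]mulrAC.
by apply: ler_wpM2r; [exact: (si_ge0 siB)|exact: kform_le].
Qed.

(* The cutoff chi is fixed once and for all: on distributions supported in E it
   computes l(1), so that the constraint l(1) = q is stable under limits. *)
Lemma Ch_test : exists chi : test R, forall l, Ch E q l <->
  [/\ dual_dirichlet l, (forall psi, fun_supp psi `&` E = set0 ->
    l psi = 0) & l chi = q].
Proof.
have [chi [_ [W [oW EW chi1]]]] := cutoff cE openT (@subsetT _ _).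
exists chi => l; split=> [[dl lE lq]|[dl lE lq]].
- split=> //; last by rewrite -lq (cvalueE oW _ chi1)//; exact: subset_trans EW.
  move=> psi psiE; apply: gf_supp_out; apply/seteqP; split=> // x [psix lx].
  by rewrite -psiE; split=> //; exact: lE.
- have lE' : gf_supp l `<=` E.
    by move=> x; apply; split=> //; exact: compact_closed.
  by split=> //; rewrite (cvalueE oW _ chi1)//; exact: subset_trans EW.
Qed.

Lemma midpoint l l' : Ch E q l -> Ch E q l' -> exists2 m, Ch E q m &
  kenergy E k m = (kenergy E k l + kenergy E k l') / 2 - B (U l - U l') (U l - U
    l') / 4.
Proof.
have [chi chiP] := Ch_test; move=> /chiP[dl lE lq] /chiP[dl' lE' lq'].
have pU := kpotentialP dl; have pU' := kpotentialP dl'.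
have [DU _] := pU; have [DU' _] := pU'.
have Dd := dirichletB DU DU'.
(* The average of the potentials, in the shape [a *: u + v] of [si_quad], so that its energy
   displays [U l - U l']. The midpoint distribution is built from [W], not by averaging [l] and
   [l']. *)
pose W := 2^-1 *: (U l - U l') + U l'.
have DW : dirichlet W by exact: dirichlet_lin.
have BW f : dirichlet f -> B f W = (B f (U l) + B f (U l')) / 2.
  move=> Df; rewrite /W (si_linr siB)// !(si_sym siB f) (si_linBl siB)//.
  by move: (B _ _) (B _ _) => *; field.
have C0 : 0 <= (4 * pi)^-1 * B W W.
  by rewrite mulr_ge0 ?(si_ge0 siB)// invr_ge0 mulr_ge0// pi_ge0.
have [m [mE dm dmE]] := @bounded_form_dual (B^~ W) _ C0
  (fun a f g Df Dg => si_linl siB a Df Dg DW) (fun f Df => kform_bound DW Df).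
exists m.
  apply/chiP; split=> // [psi psiE|].
    rewrite mE BW; last exact: dirichlet_test.
    by rewrite -!kform_test// lE// lE'// addr0 mul0r.
  rewrite mE BW; last exact: dirichlet_test.
  by rewrite -!kform_test// lq lq'; lra.
rewrite (kenergyE dm (conj DW dmE)) (kenergyE dl pU) (kenergyE dl' pU').
rewrite /W (si_quad siB _ Dd DU') (si_linBl siB DU DU' DU') (si_quadB siB DU DU').
by move: (B _ _) (B _ _) (B _ _) => *; lra.
Qed.

(** The midpoint cannot have energy below [m]. Uniqueness uses this with both energies equal to [m],
    the Cauchy property with both close to it. *)
Lemma kform_sub_le (m : R) l l' : (forall l, Ch E q l -> m <= kenergy E k l) ->
  Ch E q l -> Ch E q l' ->
  B (U l - U l') (U l - U l') <= 2 * (kenergy E k l + kenergy E k l' - 2 * m).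
Proof.
move=> mP cl cl'; have [h /mP + e] := midpoint cl cl'; rewrite {}e.
by move: (B _ _) (kenergy E k l) (kenergy E k l') => b w w' {mP cl cl'}; lra.
Qed.

Lemma sqr_sub_le l l' f : dual_dirichlet l -> dual_dirichlet l' -> dirichlet f ->
  (B f (U l) - B f (U l')) ^+ 2 <= B f f * B (U l - U l') (U l - U l').
Proof.
move=> dl dl' Df; have [DU _] := kpotentialP dl; have [DU' _] := kpotentialP dl'.
have := si_CS siB Df (dirichletB DU DU').
by rewrite (si_sym siB f) (si_linBl siB)// !(si_sym siB _ f).
Qed.

Lemma Ch_dual l : Ch E q l -> dual_dirichlet l.
Proof. by case. Qed.

Lemma minimizer_uniq (m : R) l l' : (forall l, Ch E q l -> m <= kenergy E k l) ->
  Ch E q l -> Ch E q l' -> kenergy E k l = m -> kenergy E k l' = m -> l = l'.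
Proof.
move=> mP cl cl' e e'; apply: gen_function_ext => phi.
have dl := Ch_dual cl; have dl' := Ch_dual cl'.
have Dp := dirichlet_test phi.
have := kform_sub_le mP cl cl'; rewrite e e' => h.
have := sqr_sub_le dl dl' Dp; rewrite -!kform_test// => h2.
apply/eqP; rewrite -subr_eq0 -sqrf_eq0 eq_le sqr_ge0 andbT.
apply: (le_trans h2); apply: mulr_ge0_le0; first exact: (si_ge0 siB).
by rewrite (_ : 0 = 2 * (m + m - 2 * m)); [exact: h|ring].
Qed.

Lemma gap_le4 (b w w' m x y : R) : b <= 2 * (w + w' - 2 * m) ->
  w < m + x -> w' < m + y -> y <= x -> b <= 4 * x.
Proof. by lra. Qed.

Lemma minimizer_exists (m : R) : (forall l, Ch E q l -> m <= kenergy E k l) ->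
  (forall e, 0 < e -> exists2 l, Ch E q l & kenergy E k l < m + e) ->
  exists2 l, Ch E q l & kenergy E k l = m.
Proof.
move=> mP mlim.
have /choice[l_ lP] (n : nat) :
  exists l, Ch E q l /\ kenergy E k l < m + harmonic n.
  by have [l cl el] := mlim (harmonic n) (harmonic_gt0 n); exists l.
have dl n := Ch_dual (lP n).1.
have DU n : dirichlet (U (l_ n)) by case: (kpotentialP (dl n)).
pose a f n := B f (U (l_ n)).
(* Outside the Dirichlet class this limit may be a default value; only Dirichlet [f] are used
   below. *)
pose L f := lim (a f n @[n --> \oo]).
have a_cauchy f : dirichlet f -> cvgn (a f).
  move=> Df; apply/cauchy_cvgP/cauchy_exP => e e0.
  have Bf0 := si_ge0 siB Df.
  (* For [n >= N] both energies are within [harmonic N] of [m], so the squared gap of the values at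
     [f] is at most [4 * B f f / N.+1]. *)
  have [N hN] : exists N, 4 * B f f / e ^+ 2 < N.+1%:R.
    exists (Num.bound (4 * B f f / e ^+ 2)).
    apply: (lt_trans (archi_boundP _)); last by rewrite ltr_nat.
    by rewrite divr_ge0 ?sqr_ge0// mulr_ge0.
  exists (a f N); exists N => // n Nn; rewrite /ball /=.
  suff : (a f N - a f n) ^+ 2 < e ^+ 2.
    by rewrite -(real_normK (num_real (a f N - _))) ltr_pXn2r// nnegrE ltW.
  apply: (le_lt_trans (sqr_sub_le (dl N) (dl n) Df)).
  have h := kform_sub_le mP (lP N).1 (lP n).1.
  have hn : harmonic n <= harmonic N :> R.
    by rewrite lef_pV2 ?posrE ?ltr0Sn// ler_nat ltnS.
  have h4 : B (U (l_ N) - U (l_ n)) (U (l_ N) - U (l_ n)) <= 4 * harmonic N.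
    exact: (gap_le4 h (lP N).2 (lP n).2 hn).
  apply: (le_lt_trans (ler_wpM2l Bf0 h4)).
  rewrite mulrCA mulrA ltr_pdivrMr ?ltr0Sn// [ltRHS]mulrC -ltr_pdivrMr ?exprn_gt0//.
have aL f : dirichlet f -> a f n @[n --> \oo] --> L f by exact: a_cauchy.
(* A negative [m] with tolerance [- m] would yield a distribution of negative energy. *)
have m0 : 0 <= m.
  rewrite leNgt; apply/negP => mlt0; have [|l cl] := mlim (- m);
    first by rewrite oppr_gt0.
  have [Dl hl] := kpotentialP (Ch_dual cl).
  rewrite subrr (kenergyE (Ch_dual cl) (conj Dl hl)) ltNge => /negP; apply.
  exact: (si_ge0 siB).
have L_sqr f : dirichlet f -> L f ^+ 2 <= B f f * m.
  move=> Df.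
  have c1 : a f n ^+ 2 @[n --> \oo] --> L f ^+ 2.
    by rewrite expr2; under eq_fun do rewrite expr2; apply: cvgM; exact: aL.
  have c2 : B f f * (m + harmonic n) @[n --> \oo] --> B f f * m.
    rewrite -[X in _ * X](addr0 m); apply: cvgMr; apply: cvgD; first exact: cvg_cst.
    exact: cvg_harmonic.
  apply: (ler_cvg_to c1 c2); apply: nearW => n.
  apply: (le_trans (si_CS siB Df (DU n))); apply: ler_wpM2l;
    first exact: (si_ge0 siB).
  by rewrite -(kenergyE (dl n) (kpotentialP (dl n))); exact: ltW (lP n).2.
have L_lin c f g : dirichlet f -> dirichlet g -> L (c *: f + g) = c * L f + L g.
  move=> Df Dg; apply: cvg_lim => //.
  rewrite (_ : a _ = (fun n => c * a f n + a g n)).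
    by apply: cvgD; [apply: cvgMr|]; exact: aL.
  by apply/funext => n; rewrite /a (si_linl siB).
have C0 : 0 <= (4 * pi)^-1 * m by rewrite mulr_ge0// invr_ge0 mulr_ge0// pi_ge0.
have [|l [lL dul dvl]] := bounded_form_dual C0 L_lin.
  move=> f Df; apply: (le_trans (L_sqr _ Df)); rewrite [leRHS]mulrAC.
  by apply: ler_wpM2r => //; exact: kform_le.
have [chi chiP] := Ch_test.
have lcvg phi : l_ n phi @[n --> \oo] --> l phi.
  rewrite lL (_ : (fun n => _) = a phi); first by apply: aL; exact: dirichlet_test.
  by apply/funext => n; rewrite kform_test.
have cl : Ch E q l.
  apply/chiP; split=> // [psi psiE|].
    apply: (norm_cvg_unique (lcvg psi)); rewrite (_ : (fun n => _) = cst 0);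
      first exact: cvg_cst.
    by apply/funext => n; have /chiP[_ lE _] := (lP n).1; exact: lE.
  apply: (norm_cvg_unique (lcvg chi)); rewrite (_ : (fun n => _) = cst q);
    first exact: cvg_cst.
  by apply/funext => n; have /chiP[_ _ lq] := (lP n).1; exact: lq.
exists l => //; apply/eqP; rewrite eq_le mP// andbT.
have [DUl hUl] := kpotentialP dul.
have e : kenergy E k l = L (U l) by rewrite /kenergy dvl.
have e2 : kenergy E k l = B (U l) (U l) by exact: kenergyE.
have := L_sqr _ DUl; rewrite -e -e2.
(* Cancelling one factor of the energy requires it to be positive; otherwise it is at most
   [0 <= m]. *)
have [W0|W0] := ltP 0 (kenergy E k l); last by move=> _; exact: le_trans m0.
by rewrite expr2 ler_pM2l.
Qed.

End capacity.
End dual.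

Unset Implicit Arguments.

(** Over an empty [Ch E q], as for empty [E] and nonzero [q], no minimizer can exist and the
    extended infimum is [+oo]; nonemptiness excludes this. *)
Theorem theorem17 (R : realType) (E : set (R3 R)) (q k : R) :
  compact E ->
  0 < k ->
  (k%:E <= poincare_const E)%E ->
  kpotential_exists_unique E k ->
  Ch E q !=set0 ->
  exists! l_k : gen_function R, Ch E q l_k /\
    (kenergy E k l_k)%:E = ereal_inf [set (kenergy E k l)%:E | l in Ch E q].
Proof.
move=> cE k0 kE potE [l0 cl0].
set S := [set _ | _ in _].
have siB := semi_inner_kform cE k0 kE.
have W0 l : Ch E q l -> 0 <= kenergy E k l.
  move=> /Ch_dual dl; have pU := kpotentialP potE dl.
  by rewrite (kenergyE cE k0 kE potE dl pU); apply: (si_ge0 siB); case: pU.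
have lbS : lbound S (ereal_inf S) by exact: ereal_inf_lbound.
have S0 : (0 <= ereal_inf S)%E by apply: le_ereal_inf_tmp => _ [l cl <-];
  rewrite lee_fin W0.
(* Nonnegative energies bound the infimum below and [l0] bounds it above, so it is a real number
   [m]. *)
have Sfin : ereal_inf S \is a fin_num.
  rewrite ge0_fin_numE//; apply: (@le_lt_trans _ _ (kenergy E k l0)%:E);
    last exact: ltry.
  by apply: lbS; exists l0.
pose m := fine (ereal_inf S); have Sm : ereal_inf S = m%:E by rewrite fineK.
have mP l : Ch E q l -> m <= kenergy E k l.
  by move=> cl; rewrite -lee_fin -Sm; apply: lbS; exists l.
have [|l cl el] := minimizer_exists cE k0 kE potE mP.
  move=> e e0; have : (ereal_inf S < (m + e)%:E)%E by rewrite Sm lte_fin ltrDl.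
  by move=> /ereal_inf_lt[_ [l cl <-]]; rewrite lte_fin => ?; exists l.
exists l; split; first by rewrite Sm el.
move=> l' [cl' el']; apply: (minimizer_uniq cE k0 kE potE mP cl cl' el).
by apply: EFin_inj; rewrite el' Sm.
Qed.
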